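(* Let $d\ge 1$ be an integer, $R>0$ and $p\in(0,1]$, and let $(\mathrm{RGG}_n(p,R))_{n\ge 1}$ be the sequence of $d$-dimensional random geometric graphs with connection radius $R$ and connection probability $p$. Then for every integer $k\ge 1$, $$\Phi_{\mathrm{RGG}_n(p,R)}(k)\ \xrightarrow{\ \mathbb{P}\ }\ 1+p\,\omega_d(R)\,(1-p\,p_{\mathrm{conn}})+p(k-1)\,p_{\mathrm{conn}}\qquad (n\to\infty),$$ where $\Phi$ is the average nearest neighbour degree and $$p_{\mathrm{conn}}=\frac{1}{\omega_d(R)^2}\iint_{x,y\in B(0,R)}\mathbf{1}_{\{\|x-y\|\le R\}}\,dx\,dy.$$
   Context: Random geometric graph: let $\mathbb{T}_n^d$ be the $d$-dimensional torus of volume $n$, i.e. the box $[-n^{1/d}/2,n^{1/d}/2]^d$ with opposite boundaries identified, with torus metric $\|\cdot\|_n$. $\mathrm{RGG}_n(p,R)$ has $n$ vertices placed at independent uniform points $X_1,\dots,X_n$ of the torus, and, given the positions, each pair $i\ne j$ is connected independently with probability $p\,\mathbf{1}_{\{\|X_i-X_j\|_n\le R\}}$. $B(0,R)$ is the Euclidean ball of radius $R$ around $0$ in $\mathbb{R}^d$, $\|\cdot\|$ is the Euclidean norm, and $\omega_d(R)=\frac{\pi^{d/2}}{\Gamma(1+d/2)}R^d$ is the volume of $B(0,R)$. Average nearest neighbour degree (ANND) of a finite graph $G$ with vertex degrees $d_v$: $\vec{E}(G)$ is the set of ordered pairs $(u,v)$ with $\{u,v\}\in E(G)$, $\sum_{u\to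 v}$ is summation over $\vec{E}(G)$; let $f_G(k)=\frac{1}{|V(G)|}\sum_{v\in V(G)}\mathbf{1}_{\{d_v=k\}}$, $f^*_G(k)=\frac{1}{|\vec{E}(G)|}\sum_{u\to v}\mathbf{1}_{\{d_u=k\}}$ and $h_G(k,\ell)=\frac{1}{|\vec{E}(G)|}\sum_{u\to v}\mathbf{1}_{\{d_u=k,\,d_v=\ell\}}$. For $k=1,2,\dots$, $$\Phi_G(k)=\mathbf{1}_{\{f_G(k)>0\}}\frac{\sum_{\ell>0}\ell\,h_G(k,\ell)}{f^*_G(k)},$$ interpreted as $0$ when $f_G(k)=0$. *)

(* Defs.v *)
From HB Require Import structures.
From mathcomp Require Import all_boot all_order all_algebra.
From mathcomp Require Import all_classical all_reals all_analysis.

Set Implicit Arguments.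
Unset Strict Implicit.
Unset Printing Implicit Defensive.
Import Order.TTheory GRing.Theory Num.Theory.
Import numFieldNormedType.Exports.

Local Open Scope classical_set_scope.
Local Open Scope ring_scope.

(* Points of R^d are d-tuples; d.-tuple R carries the product sigma-algebra. *)

Section volume.
Context {R : realType}.

Definition cons_point d (z : measurableTypeR R * d.-tuple R) : d.+1.-tuple R :=
  [tuple of z.1 :: z.2].

Lemma tnth_cons_point d (z : measurableTypeR R * d.-tuple R) (i : 'I_d) :
  tnth (cons_point z) (lift ord0 i) = tnth z.2 i.
Proof. by rewrite (tnth_nth 0) /= -tnth_nth. Qed.

Lemma measurable_cons_point d : measurable_fun setT (@cons_point d).
Proof. exact: measurable_cons. Qed.

Section volume_cons.
Variables (d : nat) (mu : {sigma_finite_measure set (d.-tuple R) -> \bar R}).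

Definition volume_cons : set (d.+1.-tuple R) -> \bar R :=
  pushforward (@lebesgue_measure R \x mu)%E (@cons_point d).

Let volume_cons0 : volume_cons set0 = 0%E.
Proof. by rewrite /volume_cons /pushforward preimage_set0 measure0. Qed.

Let volume_cons_ge0 A : (0 <= volume_cons A)%E.
Proof. by rewrite /volume_cons /pushforward measure_ge0. Qed.

Let volume_cons_sigma_additive : semi_sigma_additive volume_cons.
Proof.
have mc A : measurable A -> measurable (@cons_point d @^-1` A).
  by move=> mA; rewrite -[X in measurable X]setTI; exact: measurable_cons_point.
move=> F mF tF mUF; rewrite /volume_cons /pushforward preimage_bigcup.
apply: measure_semi_sigma_additive.
- by move=> n; exact: mc.
- apply/trivIsetP => i j _ _ ij; rewrite -preimage_setI.
  by move/trivIsetP : tF => /(_ _ _ _ _ ij) ->//; rewrite preimage_set0.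
- by rewrite -preimage_bigcup; exact: mc.
Qed.

HB.instance Definition _ := isMeasure.Build _ _ _ volume_cons
  volume_cons0 volume_cons_ge0 volume_cons_sigma_additive.

Let volume_cons_sigma_finite : sigma_finite setT volume_cons.
Proof.
have /sigma_finiteP[F [UF ndF Foo]] := sigma_finiteT (@lebesgue_measure R).
have /sigma_finiteP[G [UG ndG Goo]] := sigma_finiteT mu.
exists (fun k => [set x : d.+1.-tuple R |
    F k (thead x) /\ G k [tuple of behead x]]).
  apply/seteqP; split => // x _.
  have [i _ Fi] : (\bigcup_i F i) (thead x) by rewrite -UF.
  have [j _ Gj] : (\bigcup_i G i) [tuple of behead x] by rewrite -UG.
  exists (maxn i j) => //; split.
    by move: Fi; exact/subsetPset/ndF/leq_maxl.
  by move: Gj; exact/subsetPset/ndG/leq_maxr.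
move=> k; have [mF Fk] := Foo k; have [mG Gk] := Goo k; split.
  apply: measurableI.
    by rewrite -[X in measurable X]setTI; exact: measurable_tnth.
  by rewrite -[X in measurable X]setTI; exact: measurable_behead.
rewrite /volume_cons /pushforward (_ : _ @^-1` _ = F k `*` G k).
  by rewrite product_measure1E// lte_mul_pinfty// ge0_fin_numE.
apply/seteqP; split => -[x y] /= [Fx Gy]; split => //; move: Gy;
  by congr (G k _); exact: val_inj.
Qed.

HB.instance Definition _ := Measure_isSigmaFinite.Build _ _ _ volume_cons
  volume_cons_sigma_finite.

End volume_cons.

(* d-dimensional Lebesgue measure; volume_box below characterizes it. *)
Fixpoint volume d : {sigma_finite_measure set (d.-tuple R) -> \bar R} :=
  match d with
  | 0 => \d_([tuple])
  | d'.+1 => volume_cons (volume d')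
  end.

Lemma volume_box d (A : 'I_d -> set R) : (forall i, measurable (A i)) ->
  volume d [set x | forall i, A i (tnth x i)] =
  (\prod_(i < d) (@lebesgue_measure R (A i)))%E.
Proof.
elim: d A => [|d IH] A mA.
  rewrite big_ord0 /= diracE mem_set//=.
  by move=> [].
rewrite big_ord_recl -IH//.
rewrite -product_measure1E; last 2 first.
- exact: mA.
- rewrite (_ : [set x | _] =
      \bigcap_(i in setT) (fun x => tnth x i) @^-1` A (lift ord0 i)).
    apply: fin_bigcap_measurable => // i _.
    by rewrite -[X in measurable X]setTI; exact: measurable_tnth.
  by apply/seteqP; split => [x Ax i _|x Ax i]; exact: Ax.
rewrite /= /volume_cons /pushforward; congr (product_measure1 _ _ _).
apply/seteqP; split => -[x y] /=.
  move=> H; split; first exact: (H ord0).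
  by move=> i; have := H (lift ord0 i); rewrite tnth_cons_point.
move=> [Hx Hy] i; have [j ->|->] := unliftP ord0 i; last exact: Hx.
by rewrite tnth_cons_point; exact: Hy.
Qed.

End volume.

Section euclidean.
Context {R : realType}.

Definition point_sub d (x y : d.-tuple R) : d.-tuple R :=
  [tuple tnth x i - tnth y i | i < d].

Definition enorm d (x : d.-tuple R) : R :=
  Num.sqrt (\sum_(i < d) tnth x i ^+ 2).

Definition eball d (r : R) : set (d.-tuple R) := [set x | enorm x <= r].
Arguments eball : clear implicits.

Definition Gamma (z : R) : R :=
  \int[lebesgue_measure]_(t in `]0, +oo[) (t `^ (z - 1) * expR (- t)).

Definition omega d (r : R) : R :=
  pi `^ (d%:R / 2) / Gamma (1 + d%:R / 2) * r ^+ d.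

Definition p_conn d (r : R) : R :=
  (omega d r ^+ 2)^-1 *
  \int[volume d]_(x in eball d r) \int[volume d]_(y in eball d r)
    (enorm (point_sub x y) <= r)%R%:R.

End euclidean.

Section torus.
Context {R : realType} (d n : nat).

Definition torus_side : R := n%:R `^ d%:R^-1.

Definition torus_box : set (d.-tuple R) :=
  [set x | forall i, - (torus_side / 2) <= tnth x i <= torus_side / 2].

(* Quotient metric of R^d modulo (torus_side * Z)^d: the distance between
   x and y is the least Euclidean distance from x to a lattice translate
   of y. *)
Definition torus_dist (x y : d.-tuple R) : R :=
  inf [set enorm (point_sub x [tuple tnth y i + torus_side * (tnth k i)%:~R
                              | i < d])
      | k in [set: d.-tuple int]].

End torus.
Arguments torus_side {R} d n.
Arguments torus_box {R} d n.
Arguments torus_dist {R d} n x y.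

Record simple_graph (V : finType) := SimpleGraph {
  adj :> rel V ;
  adj_sym : symmetric adj ;
  adj_irrefl : irreflexive adj }.

Section annd.
Context {R : realType} {V : finType}.
Variable G : simple_graph V.

Definition degree (v : V) : nat := #|[pred u | adj G v u]|.

Definition dir_edges : {set V * V} := [set e | adj G e.1 e.2]%SET.

Definition deg_freq (k : nat) : R :=
  #|V|%:R^-1 * \sum_(v : V) (degree v == k)%:R.

Definition size_biased_deg_freq (k : nat) : R :=
  #|dir_edges|%:R^-1 * \sum_(e in dir_edges) (degree e.1 == k)%:R.

Definition joint_deg_freq (k l : nat) : R :=
  #|dir_edges|%:R^-1 *
  \sum_(e in dir_edges) ((degree e.1 == k) && (degree e.2 == l))%:R.

Definition annd (k : nat) : R :=
  (0 < deg_freq k)%R%:R *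
  ((\big[+%R/0]_(1 <= l <oo) (l%:R * joint_deg_freq k l)) /
   size_biased_deg_freq k).

End annd.

Section probability.
Context {R : realType} {dO : measure_display} {Omega : measurableType dO}.
Variable P : probability Omega R.

Definition mutually_independent (I : finType) dT (T : measurableType dT)
    (X : I -> {RV P >-> T}) : Prop :=
  forall (J : {set I}) (A : I -> set T), (forall i, measurable (A i)) ->
  P [set w | forall i, i \in J -> A i (X i w)] =
  (\prod_(i in J) P (X i @^-1` A i))%E.

Variables (d n : nat) (p r : R).

(* In rgg_edges, [set w | B (X w)] ranges over the sigma-algebra generated by
   the positions, so the equation says that, conditionally on the positions,
   the events {i ~ j} for i < j are mutually independent, of conditional
   probability p 1{|X_i - X_j|_n <= r}. *)
Record is_RGG (X : 'I_n -> {RV P >-> (d.-tuple R)})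
    (G : Omega -> simple_graph 'I_n) : Prop := IsRGG {
  rgg_uniform : forall i (A : set (d.-tuple R)), measurable A ->
    P (X i @^-1` A) = (n%:R^-1%:E * volume d (A `&` torus_box d n))%E ;
  rgg_indep : mutually_independent X ;
  rgg_measurable : forall i j, measurable [set w | adj (G w) i j] ;
  rgg_edges : forall (B : set (n.-tuple (d.-tuple R))) (E : {set 'I_n * 'I_n}),
    measurable B -> (forall e, e \in E -> (e.1 < e.2)%N) ->
    P ([set w | B [tuple X i w | i < n]] `&`
       [set w | forall e, e \in E -> adj (G w) e.1 e.2]) =
    (\int[P]_(w in [set w | B [tuple X i w | i < n]])
       (\prod_(e in E)
          (p * (torus_dist n (X e.1 w) (X e.2 w) <= r)%R%:R))%:E)%E }.

End probability.

(* Each Y n may live on its own probability space. *)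
Definition cvg_in_probability {R : realType} (dO : nat -> measure_display)
    (Omega : forall n, measurableType (dO n)) (P : forall n, probability (Omega n) R)
    (Y : forall n, Omega n -> R) (c : R) : Prop :=
  forall eps : R, 0 < eps ->
  (fun n => P n [set w | eps < `|Y n w - c|]) @ \oo --> 0%E.

(* Main.v *)
(*
The average nearest neighbour degree at k is S / (k C), where C is the number of
vertices of degree k and S is the sum, over these vertices, of the degrees of
their neighbours. Both C / n and S / n concentrate, so the limit is the ratio of
the limits of the means.

Means. The reflections y |-> a - y of the torus preserve the uniform law, so
attaching a pendant edge to a pattern multiplies the probability that the
pattern occurs by q = p omega / n, and as soon as n^(1/d) > 4 r a triangle
occurs with probability t = p^3 omega^2 p_conn / n^2. By inclusion-exclusion q
and t determine the law of a degree (binomial) and the mean of S, and the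
Poisson limit gives the announced value. The identity omega(r) = |B(0, r)| comes
from integrating exp(-|x|^2) in layers.

Concentration. The law of the edge set is determined by the probabilities of the
events {A included in E}, so the graph may be replaced by one where each vertex
carries its position and its own coins, all independent. Deleting a vertex of
degree D changes a truncated version of S by O(1 + D), hence Efron-Stein bounds
its variance by O(n); the exponential moments of the degrees control the
truncation error in mean.
*)
From HB Require Import structures.
Require Import Defs.
From mathcomp Require Import all_boot all_order all_algebra.
From mathcomp Require Import all_classical all_reals all_analysis.
From mathcomp Require Import measurable_realfun ring lra zify.

Set Implicit Arguments.
Unset Strict Implicit.
Unset Printing Implicit Defensive.
Import Order.TTheory GRing.Theory Num.Theory.
Import numFieldNormedType.Exports.

Local Open Scope ring_scope.

(** * Random graphs with given pendant-edge and triangle probabilities *)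

(** The obstacle is that S is not local enough. Deleting a vertex i changes the degrees of its
    neighbours v, hence the summands of all neighbours of those v, and their number is not bounded
    in terms of the degree of i. Capping the degrees in S at M leaves only those v of degree at most
    M, so at most M deg(i) unit changes. The cap costs at most (4/M) times the sum of the 2^deg,
    whose mean is at most n e^lambda with lambda the limiting mean degree, so M can be fixed before
    n grows. S and C are not compared with their limits separately. With c the announced limit and K
    = k c, the error of the ratio S / (k C) is (S - K C) / (k C); it suffices that S - K C is o(n)
    in probability and that C is at least a constant times n. Efron-Stein needs independent
    coordinates indexed by vertices, whereas the edges are only conditionally independent given the
    positions; this is why coins are handed to vertices. The bound 4 r on the side of the torus
    comes from two points of the ball: their coordinates differ by at most 2 r, less than half the
    side, so their torus distance is Euclidean. *)

(* Edge sets are sets of increasing pairs; opair u v encodes the edge {u, v}. *)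
Definition opair n (u v : 'I_n) : 'I_n * 'I_n := if (u < v)%N then (u, v) else (v, u).

Lemma opairC n (u v : 'I_n) : opair u v = opair v u.
Proof.
by rewrite /opair; case: (ltngtP u v) => [//|//|/val_inj ->].
Qed.

Lemma opair_lt n (u v : 'I_n) : u != v -> ((opair u v).1 < (opair u v).2)%N.
Proof.
rewrite /opair -val_eqE/= => uv.
by case: (ltnP u v) => //= vu; rewrite ltn_neqAle vu andbT eq_sym.
Qed.

(** Only the edges at [i] go: [i] stays as an isolated vertex, so the same functions of edge sets
    over ['I_n] apply before and after. *)
Definition del n (i : 'I_n) (E : {set 'I_n * 'I_n}) : {set 'I_n * 'I_n} :=
  [set e in E | (e.1 != i) && (e.2 != i)].

(** Pays for the truncation error, a sum of cubes of degrees. The constant 4 is attained at [d = 4],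
    after which each step less than doubles the cube. *)
Lemma expn2_cube d : (d ^ 3 <= 4 * 2 ^ d)%N.
Proof.
have [d4|] := leqP d 4; first by move: d d4; do 5?[case=> //].
elim: d => // d IH; rewrite ltnS leq_eqVlt => /predU1P[<-//|d4].
have h : (5 * (d * d) <= d * (d * d))%N by rewrite leq_mul2r d4 orbT.
have := IH d4; rewrite !expnS !expn0; move: (2 ^ d)%N => z; nia.
Qed.

Lemma expn2_sqr d : ((1 + d) ^ 2 <= 4 * 2 ^ d)%N.
Proof.
have [d4|] := leqP d 2; first by move: d d4; do 3?[case=> //].
elim: d => // d IH; rewrite ltnS leq_eqVlt => /predU1P[<-//|d4].
have := IH d4; rewrite !expnS !expn0; move: (2 ^ d)%N => z; nia.
Qed.

(** * Neighbourhoods and degrees in an edge set *)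

Section neighbours.
Context {n : nat}.
Implicit Types (E A : {set 'I_n * 'I_n}) (u v w i : 'I_n).

(** [E] may be any set of ordered pairs: [v != u] discards a loop [(u, u)], and decreasing pairs are
    never looked at. *)
Definition nb E u : {set 'I_n} := [set v | (v != u) && (opair u v \in E)].
Definition deg E u : nat := #|nb E u|.

Lemma nbC E u v : (v \in nb E u) = (u \in nb E v).
Proof. by rewrite !inE opairC eq_sym. Qed.

Lemma nb_neq E u v : v \in nb E u -> v != u.
Proof. by rewrite inE => /andP[]. Qed.

Lemma nb_del E i u : nb (del i E) u = if u == i then finset.set0 else nb E u :\ i.
Proof.
apply/setP => v; case: (eqVneq u i) => [->|ui]; rewrite !inE /opair.
  by case: ifP => _ /=; rewrite eqxx ?andbF.
case: (eqVneq v i) => [->|vi]; first by case: ifP => _ /=; rewrite eqxx ?andbF.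
by case: ifP => _ /=; rewrite ?ui ?vi ?andbT.
Qed.

Lemma deg_del E i u : u != i -> deg E u = ((u \in nb E i) + deg (del i E) u)%N.
Proof. by move=> ui; rewrite /deg nb_del (negbTE ui) (cardsD1 i) nbC. Qed.

Lemma deg_lt E u : (deg E u < n)%N.
Proof.
have : (deg E u <= #|[set~ u]|)%N.
  by apply/subset_leq_card/fintype.subsetP => v /nb_neq; rewrite !inE.
rewrite cardsC1 card_ord => /leq_ltn_trans; apply.
by rewrite ltn_predL (leq_ltn_trans (leq0n u)).
Qed.

(** Double counting: each [v] is met once from each of its neighbours. *)
Lemma sum_deg_swap E (f : 'I_n -> nat) :
  (\sum_u \sum_(v in nb E u) f v = \sum_v f v * deg E v)%N.
Proof.
rewrite (exchange_big_dep xpredT)//=; apply: eq_bigr => v _.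
rewrite mulnC /deg -sum_nat_const; apply: eq_bigl => u.
by rewrite nbC.
Qed.

End neighbours.

(** * Moments and tail bounds under an abstract edge law *)

Section graph_law.
Context {R : realType} {n : nat}.
Variable pr : {set 'I_n * 'I_n} -> R.
Local Notation es := {set 'I_n * 'I_n}.
Implicit Types (E A : es) (u v w i : 'I_n) (f g : es -> R).

Definition Ex f := \sum_E pr E * f E.

Lemma eq_Ex f g : (forall E, f E = g E) -> Ex f = Ex g.
Proof. by move=> fg; apply: eq_bigr => E _; rewrite fg. Qed.

Lemma ExD f g : Ex (fun E => f E + g E) = Ex f + Ex g.
Proof. by rewrite -big_split/=; apply: eq_bigr => E _; rewrite mulrDr. Qed.

Lemma ExB f g : Ex (fun E => f E - g E) = Ex f - Ex g.
Proof. by rewrite -sumrB; apply: eq_bigr => E _; rewrite mulrBr. Qed.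

Lemma ExZ c f : Ex (fun E => c * f E) = c * Ex f.
Proof. by rewrite mulr_sumr; apply: eq_bigr => E _; rewrite mulrCA. Qed.

Lemma Ex_sum (I : finType) (P : pred I) (f : I -> es -> R) :
  Ex (fun E => \sum_(i | P i) f i E) = \sum_(i | P i) Ex (f i).
Proof. by rewrite exchange_big/=; apply: eq_bigr => E _; rewrite mulr_sumr. Qed.

(** These upward sums determine [pr] ([upset_sum_inj]), and they are what the geometry can
    compute. *)
Definition up A := Ex (fun E => (A \subset E)%:R).

(* These are the only properties of the edge law that the asymptotics needs:
   invariance of the torus makes pendant edges independent of the rest, and
   rg_variance is Efron-Stein for vertex deletions. *)
Record random_graph (q t : R) : Prop := RandomGraph {
  rg_ge0 : forall E, 0 <= pr E;
  rg_sum : \sum_E pr E = 1;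
  rg_leaf : forall A u w, u != w ->
    (forall e, e \in A -> [/\ (e.1 < e.2)%N, e.1 != w & e.2 != w]) ->
    up (opair u w |: A) = q * up A;
  rg_triangle : forall u v w, u != v -> v != w -> u != w ->
    up [set opair u v; opair v w; opair u w] = t;
  rg_variance : forall f,
    Ex (fun E => f E ^+ 2) - Ex f ^+ 2 <=
    \sum_(i < n) Ex (fun E => (f E - f (del i E)) ^+ 2) }.

Variables q t : R.
Hypothesis rg : random_graph q t.

Lemma Ex_cst c : Ex (fun=> c) = c.
Proof. by rewrite /Ex -mulr_suml (rg_sum rg) mul1r. Qed.

Lemma le_Ex f g : (forall E, f E <= g E) -> Ex f <= Ex g.
Proof. by move=> fg; apply: ler_sum => E _; rewrite ler_wpM2l// (rg_ge0 rg). Qed.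

Lemma up0 : up finset.set0 = 1.
Proof. by rewrite -[RHS](Ex_cst 1); apply: eq_Ex => E; rewrite finset.sub0set. Qed.

Definition avoids A (V : {set 'I_n}) :=
  forall e, e \in A -> [/\ (e.1 < e.2)%N, e.1 \notin V & e.2 \notin V].

Lemma avoidsW A (V W : {set 'I_n}) : V \subset W -> avoids A W -> avoids A V.
Proof.
move=> /fintype.subsetP VW AW e /AW[? e1 e2]; split => //.
  by apply: contra e1; exact: VW.
by apply: contra e2; exact: VW.
Qed.

(** The vertices of [B] are attached to [u] one at a time as leaves, each at cost [q]; [u] itself
    may lie on edges of [A]. *)
Lemma up_star A u (B : {set 'I_n}) : u \notin B -> avoids A B ->
  Ex (fun E => (A \subset E)%:R * (B \subset nb E u)%:R) = q ^+ #|B| * up A.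
Proof.
have [m] := ubnP #|B|; elim: m A B => // m IH A B Bm uB AB.
have [->|[w wB]] := set_0Vmem B.
  rewrite cards0 expr0 mul1r; apply: eq_Ex => E.
  by rewrite finset.sub0set mulr1.
have uw : u != w by apply: contraNneq uB => ->.
have wBm : (#|B :\ w| < m)%N by move: Bm; rewrite (cardsD1 w) wB.
(* The edge [u w] moves from the star into the pattern; it avoids [B :\ w] because [u] is not in
   [B]. *)
transitivity (Ex (fun E => ((opair u w |: A) \subset E)%:R * ((B :\ w) \subset nb E u)%:R)).
  apply: eq_Ex => E; rewrite -!natrM !mulnb; congr (nat_of_bool _)%:R.
  rewrite finset.subUset finset.sub1set -[in LHS](finset.setD1K wB) finset.subUset finset.sub1set inE.
  rewrite eq_sym uw/=; case: (_ \in E); case: (A \subset E) => //=.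
rewrite IH//.
- rewrite (rg_leaf rg)//.
    by rewrite (cardsD1 w B) wB exprS mulrCA mulrA.
  by move=> e /AB[e12 e1 e2]; split => //; [apply: contraNneq e1|apply: contraNneq e2] => ->.
- by rewrite !inE (negbTE uB) andbF.
move=> e; rewrite !inE => /orP[/eqP ->|/AB[e12 e1 e2]]; last first.
  by split => //; rewrite negb_and ?e1 ?e2 orbT.
split; first exact: opair_lt.
  by rewrite /opair; case: ifP => _ /=; rewrite ?eqxx// (negbTE uB) andbF.
by rewrite /opair; case: ifP => _ /=; rewrite ?eqxx// (negbTE uB) andbF.
Qed.

(** Inclusion-exclusion, one vertex at a time: the indicator that [w] is not a neighbour is 1 minus
    the indicator that it is, and the second term moves [w] from [C] to [B]. *)
Lemma Ex_nb_exact A u (B C : {set 'I_n}) : u \notin B -> u \notin C ->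
  [disjoint B & C] -> avoids A (B :|: C) ->
  Ex (fun E => (A \subset E)%:R *
    ((B \subset nb E u) && [disjoint C & nb E u])%:R) =
  q ^+ #|B| * (1 - q) ^+ #|C| * up A.
Proof.
have [m] := ubnP #|C|; elim: m B C => // m IH B C Cm uB uC BC ABC.
have [C0|[w wC]] := set_0Vmem C.
  rewrite {}C0 in Cm uC BC ABC *; rewrite cards0 expr0 mulr1 -(@up_star A u B)//; last first.
    by rewrite finset.setU0 in ABC.
  by apply: eq_Ex => E; rewrite finset.disjoints_subset finset.sub0set andbT.
have wB : w \notin B by apply/negP => wB; rewrite (disjointFr BC wB) in wC.
have uw : u != w by apply: contraNneq uC => ->.
have CmW : (#|C :\ w| < m)%N by move: Cm; rewrite (cardsD1 w) wC.
have CwC : C :\ w \subset C by exact: finset.subsetDl.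
have uCw : u \notin C :\ w by rewrite !inE (negbTE uC) andbF.
transitivity (Ex (fun E => (A \subset E)%:R *
      ((B \subset nb E u) && [disjoint C :\ w & nb E u])%:R -
    (A \subset E)%:R *
      (((w |: B) \subset nb E u) && [disjoint C :\ w & nb E u])%:R)).
  apply: eq_Ex => E; rewrite -mulrBr; congr (_ * _).
  rewrite -[in LHS](finset.setD1K wC) finset.subUset finset.sub1set.
  rewrite !finset.disjoints_subset finset.subUset finset.sub1set finset.in_setC.
  by case: (w \in nb E u); case: (B \subset _); case: (_ \subset _); rewrite /= ?subr0 ?subrr.
rewrite ExB IH//; last 2 first.
- by apply: disjointWr BC.
- by apply: avoidsW ABC; rewrite finset.setUS.
rewrite IH//; last 3 first.
- by rewrite !inE negb_or uw.
- rewrite finset.disjoints_subset finset.subUset finset.sub1set !inE eqxx/=.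
  by rewrite -finset.disjoints_subset; apply: disjointWr BC.
- apply: avoidsW ABC; rewrite -finset.setUA finset.subUset finset.sub1set !inE wC orbT/=.
  by rewrite finset.setUS.
rewrite cardsU1 wB (cardsD1 w C) wC !exprS; ring.
Qed.

Definition binpmf m j : R := 'C(m, j)%:R * q ^+ j * (1 - q) ^+ (m - j).

(** Sum over the exact neighbourhood [B] of [u] inside [V]. The factor [up A] expresses that the
    degree into [V] is independent of the occurrence of [A], even when [A] has edges at [u]; this
    makes binomial laws available around paths and triangles. *)
Lemma Ex_deg_in A u (V : {set 'I_n}) j : u \notin V -> avoids A V ->
  Ex (fun E => (A \subset E)%:R * (#|nb E u :&: V| == j)%:R) =
  binpmf #|V| j * up A.
Proof.
move=> uV AV.
transitivity (Ex (fun E => \sum_(B : {set 'I_n} | (B \subset V) && (#|B| == j))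
   (A \subset E)%:R * ((B \subset nb E u) && [disjoint V :\: B & nb E u])%:R)).
  apply: eq_Ex => E; rewrite -mulr_sumr; congr (_ * _).
  have BE (B : {set 'I_n}) : B \subset V ->
      (B \subset nb E u) && [disjoint V :\: B & nb E u] = (B == nb E u :&: V).
    move=> BV; rewrite finset.eqEsubset finset.subsetI BV andbT; congr (_ && _).
    apply/idP/fintype.subsetP => [dV v|H].
      rewrite inE => /andP[vn vV]; apply/negPn/negP => vB.
      by have := disjointFl dV vn; rewrite !inE vB vV.
    rewrite disjoint_sym; apply/pred0P => v /=; rewrite !inE -/(nb E u).
    apply/negP => /andP[vn /andP[/negP vB vV]]; apply/vB/H.
    by rewrite inE vV andbT inE.
  case: eqP => [cj|cj].
    rewrite (bigD1 (nb E u :&: V))/=; last by rewrite finset.subsetIr cj eqxx.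
    rewrite BE ?finset.subsetIr// eqxx big1 ?addr0// => B /andP[/andP[BV _] nB].
    by rewrite BE// (negbTE nB).
  rewrite big1// => B /andP[BV /eqP Bj]; rewrite BE//.
  by case: eqP => // BE'; rewrite -BE' Bj in cj.
rewrite Ex_sum (eq_bigr (fun=> q ^+ j * (1 - q) ^+ (#|V| - j) * up A)); last first.
  move=> B /andP[BV /eqP Bj]; rewrite Ex_nb_exact//.
  - by rewrite cardsD (finset.setIidPr BV) Bj.
  - by apply: contra uV; exact: (fintype.subsetP BV).
  - by rewrite !inE (negbTE uV) andbF.
  - by rewrite finset.disjoints_subset; apply/fintype.subsetP => v vB; rewrite !inE vB.
  - by apply: avoidsW AV; rewrite finset.subUset BV finset.subsetDl.
rewrite sumr_const -[LHS]mulr_natl /binpmf -cards_draws.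
rewrite (_ : #|_| = #|[set B : {set 'I_n} | (B \subset V) & (#|B| == j)]|); last first.
  by apply: eq_card => B; rewrite !inE.
by rewrite !mulrA.
Qed.

Lemma Ex_deg u k : Ex (fun E => (deg E u == k)%:R) = binpmf n.-1 k.
Proof.
have := @Ex_deg_in finset.set0 u [set~ u] k; rewrite up0 mulr1 cardsC1 card_ord.
move=> <-.
- apply: eq_Ex => E; rewrite finset.sub0set mul1r (finset.setIidPl _)//.
  by apply/fintype.subsetP => v /nb_neq; rewrite !inE.
- by rewrite !inE eqxx.
- by move=> e; rewrite inE.
Qed.

Lemma Ex_fun_deg u (f : nat -> R) :
  Ex (fun E => f (deg E u)) = \sum_(j < n) f j * binpmf n.-1 j.
Proof.
transitivity (Ex (fun E => \sum_(j < n) f j * (deg E u == j)%:R)).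
  apply: eq_Ex => E; rewrite (bigD1 (Ordinal (deg_lt E u)))//= eqxx mulr1.
  rewrite big1 ?addr0// => j; rewrite -val_eqE/= eq_sym => /negbTE ->.
  by rewrite mulr0.
by rewrite Ex_sum; apply: eq_bigr => j _; rewrite ExZ Ex_deg.
Qed.

(** Binomial theorem for [(1 - q) + 2 * q]. This exponential moment is the only degree moment that
    enters the error bounds. *)
Lemma Ex_exp2_deg u : Ex (fun E => 2 ^+ deg E u) = (1 + q) ^+ n.-1.
Proof.
rewrite (Ex_fun_deg u (fun j => 2 ^+ j)).
have n0 : (0 < n)%N by exact: leq_ltn_trans (leq0n u) (ltn_ord u).
transitivity (\sum_(j < n.-1.+1) 2 ^+ j * binpmf n.-1 j); first by rewrite prednK.
rewrite (_ : 1 + q = (1 - q) + 2 * q); last by ring.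
rewrite exprDn; apply: eq_bigr => j _; rewrite /binpmf exprMn -mulr_natl; ring.
Qed.

Definition nbdeg E u : nat := \sum_(v in nb E u) deg E v.

(** The shift accounts for a closed triangle: [w] is then itself a neighbour of [u], which leaves
    one neighbour fewer among the other vertices. *)
Definition tri_pmf m k : R := if k is k'.+1 then binpmf m k' else 0.

(** Split according to whether [u w] is an edge. If so, [u] has [k - 1] neighbours among the other
    [n - 3] vertices, otherwise [k]; the path without its closing edge has probability
    [q ^+ 2 - t]. *)
Lemma Ex_path_deg u v w k : u != v -> v != w -> u != w ->
  Ex (fun E => (deg E u == k.+1)%:R * ((v \in nb E u)%:R * (w \in nb E v)%:R)) =
  t * tri_pmf (n - 3) k + (q ^+ 2 - t) * binpmf (n - 3) k.
Proof.
move=> uv vw uw.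
pose V := ~: [set u; v; w]; pose A2 := [set opair u v; opair v w].
pose A3 := [set opair u v; opair v w; opair u w].
have cV : #|V| = (n - 3)%N.
  rewrite cardsCs finset.setCK card_ord -finset.setUA cardsU1 cards2 vw.
  by rewrite !inE negb_or uv uw.
have oE (a b : 'I_n) E : a != b -> (b \in nb E a) = (opair a b \in E).
  by move=> ab; rewrite inE eq_sym ab.
have aV A : A \subset A3 -> avoids A V.
  move=> /fintype.subsetP AA e /AA; rewrite !inE -orbA => /or3P[] /eqP ->;
  by split; [exact: opair_lt|..]; rewrite /opair; case: ifP => _ /=; rewrite ?eqxx ?orbT.
have uV : u \notin V by rewrite !inE eqxx.
have upA2 : up A2 = q ^+ 2.
  rewrite /A2 finset.setUC (rg_leaf rg)//.
    rewrite -(finset.setU0 [set opair u v]) (rg_leaf rg) ?up0 ?mulr1 ?expr2// => e.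
    by rewrite inE.
  move=> e; rewrite inE => /eqP ->; split; first exact: opair_lt.
    by rewrite /opair; case: ifP.
  by rewrite /opair; case: ifP.
have upA3 : up A3 = t by rewrite (rg_triangle rg).
have A23 : A2 \subset A3 by exact: finset.subsetUl.
pose c E := #|nb E u :&: V|.
have degE E : deg E u = ((v \in nb E u) + (w \in nb E u) + c E)%N.
  rewrite /deg (cardsD1 v) -addnA; congr (_ + _)%N.
  rewrite (cardsD1 w) !inE (eq_sym w v) vw/=; congr (_ + _)%N; apply: eq_card => x.
  rewrite !inE; case: (eqVneq x w) => [->|]; rewrite ?orbT ?andbF//.
  by case: (eqVneq x v); rewrite ?orbT ?andbF//=; case: (x == u); rewrite ?andbF ?andbT.
transitivity (Ex (fun E => (A3 \subset E)%:R * (if k is k'.+1 then (c E == k')%:R else 0) +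
    ((A2 \subset E)%:R * (c E == k)%:R - (A3 \subset E)%:R * (c E == k)%:R))).
  apply: eq_Ex => E; rewrite degE /A3 /A2 !finset.subUset !finset.sub1set !oE//.
  case: (opair u v \in E); case: (opair v w \in E); case: (opair u w \in E);
    rewrite /= ?(mulr0, mul0r, subrr, addr0, add0r, mulr1, mul1r, subr0)//.
  by case: (k).
rewrite ExD ExB !Ex_deg_in ?upA2 ?upA3 ?cV//; try exact: aV.
rewrite (_ : Ex _ = t * tri_pmf (n - 3) k); first by ring.
rewrite /tri_pmf; case: (k) => [|k'].
  by rewrite mulr0 -[RHS](Ex_cst 0); apply: eq_Ex => E; rewrite mulr0.
by rewrite Ex_deg_in ?upA3 ?cV 1?mulrC//; exact: aV.
Qed.

(** Each neighbour [v] contributes [u] itself, [k.+1] in total, and every third vertex [w] adjacent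
    to [v]; the latter range over the [(n - 1) * (n - 2)] paths treated by [Ex_path_deg]. *)
Lemma Ex_deg_nbdeg u k :
  Ex (fun E => (deg E u == k.+1)%:R * (nbdeg E u)%:R) =
  k.+1%:R * binpmf n.-1 k.+1 + (n.-1 * n.-2)%:R *
  (t * tri_pmf (n - 3) k + (q ^+ 2 - t) * binpmf (n - 3) k).
Proof.
have n0 : (0 < n)%N by exact: leq_ltn_trans (leq0n u) (ltn_ord u).
pose F v w E : R := (deg E u == k.+1)%:R * ((v \in nb E u)%:R * (w \in nb E v)%:R).
transitivity (Ex (fun E => k.+1%:R * (deg E u == k.+1)%:R +
    \sum_(v | v != u) \sum_(w | (w != u) && (w != v)) F v w E)).
  apply: eq_Ex => E.
  rewrite /nbdeg natr_sum mulr_sumr.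
  transitivity (\sum_(v in nb E u) ((deg E u == k.+1)%:R +
      \sum_(w | (w != u) && (w != v)) F v w E)).
    apply: eq_bigr => v vu; rewrite /F vu.
    under eq_bigr do rewrite mul1r.
    rewrite -mulr_sumr -[X in X + _]mulr1 -mulrDr; congr (_ * _).
    rewrite /deg -sum1_card natr_sum big_mkcond/= (bigD1 u)//= nbC vu; congr (_ + _).
    rewrite [RHS]big_mkcondr/= [RHS]big_mkcond [LHS]big_mkcond; apply: eq_bigr => w _.
    case: (w != u) => //=; case: (eqVneq w v) => [->|_] /=; last by case: (w \in nb E v).
    by case: ifP => // /nb_neq; rewrite eqxx.
  rewrite big_split/= sumr_const -/(deg E u); congr (_ + _).
    by case: eqP => [->|_]; rewrite ?mulr1 ?mulr0 ?mul0rn.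
  rewrite [RHS](bigID (mem (nb E u)))/= [X in _ = _ + X]big1 ?addr0; last first.
    by move=> v /andP[_ /negbTE vu]; rewrite big1// => w _; rewrite /F vu mul0r mulr0.
  by apply: eq_bigl => v; apply/esym/andb_idl => /nb_neq.
rewrite ExD ExZ Ex_deg Ex_sum; congr (_ + _).
under eq_bigr do rewrite Ex_sum.
set X := (X in _ = _ * X).
transitivity (\sum_(v : 'I_n | v != u) \sum_(w : 'I_n | (w != u) && (w != v)) X).
  apply: eq_bigr => v vu; apply: eq_bigr => w /andP[wu wv].
  by rewrite /F Ex_path_deg// eq_sym.
transitivity (\sum_(v : 'I_n | v != u) n.-2%:R * X).
  apply: eq_bigr => v vu; rewrite sumr_const -[LHS]mulr_natl; congr (_%:R * _).
  rewrite (eq_card (B := mem (~: [set u; v]))); last first.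
    by move=> w; rewrite !inE negb_or.
  by rewrite cardsCs finset.setCK card_ord cards2 eq_sym vu subn2.
rewrite sumr_const -[LHS]mulr_natl mulrA natrM; congr (_%:R * _ * _).
rewrite (eq_card (B := mem [set~ u])); last by move=> w; rewrite !inE.
by rewrite cardsC1 card_ord.
Qed.

(** * Effect of a vertex deletion on truncated sums *)

Section truncated_sum.
Variables (k M : nat) (K : R).

(** For [M = 0] and [K = -1] this is the indicator of degree [k], so one variance bound serves both
    the truncated sum and the vertex count. *)
Definition trunc E u : R :=
  (deg E u == k)%:R * ((\sum_(v in nb E u) minn (deg E v) M)%:R - K).

Definition trunc_sum E : R := \sum_u trunc E u.

Lemma trunc_le E u : `|trunc E u| <= (k * M)%:R + `|K|.
Proof.
rewrite /trunc; case: eqP => [dk|_]; last first.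
  by rewrite mul0r normr0 addr_ge0.
rewrite mul1r (le_trans (ler_normB _ _))// lerD2r normr_nat ler_nat -dk /deg -sum_nat_const.
by apply: leq_sum => v _; rewrite geq_minr.
Qed.

(* Deleting i affects the summand of u only if u = i, if u is a neighbour of i,
   or if some neighbour v of u with degree at most M is a neighbour of i. *)
Lemma trunc_del E i u : (0 < k)%N ->
  `|trunc E u - trunc (del i E) u| <=
  ((u == i) || (u \in nb E i))%:R * (2 * ((k * M)%:R + `|K|)) +
  (\sum_(v in nb E u) ((v \in nb E i) && (deg E v <= M)))%:R.
Proof.
move=> k0; case: (boolP (_ || _)) => [_|].
  rewrite mul1r (le_trans (ler_normB _ _))// -[leLHS]addr0 lerD//.
  by rewrite mulrDl mul1r lerD// trunc_le.
rewrite negb_or => /andP[ui uni]; rewrite mul0r add0r.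
have nbu : nb (del i E) u = nb E u.
  rewrite nb_del (negbTE ui); apply/setP => v; rewrite finset.in_setD1.
  by case: (eqVneq v i) => [->|//]; rewrite nbC (negbTE uni).
have dE : deg (del i E) u = deg E u by rewrite /deg nbu.
rewrite /trunc dE nbu -mulrBr normrM.
apply: (@le_trans _ _ (1 * (\sum_(v in nb E u) ((v \in nb E i) && (deg E v <= M)%N))%:R)); last by rewrite mul1r.
apply: ler_pM => //; first by case: eqP; rewrite ?normr1 ?normr0.
rewrite opprB addrA subrK.
(* Removing [i] lowers the capped degree of [v] by one exactly when [v] is adjacent to [i] and its
   degree is at most [M]. *)
rewrite (_ : \sum_(v in nb E u) minn (deg E v) M = (\sum_(v in nb E u) minn (deg (del i E) v) M +
  \sum_(v in nb E u) ((v \in nb E i) && (deg E v <= M)))%N).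
  by rewrite natrD addrAC subrr add0r normr_nat.
rewrite -big_split/=; apply: eq_bigr => v vu.
have vi : v != i by apply: contraNneq uni => <-; rewrite nbC.
rewrite (deg_del E vi); case: (v \in nb E i) => /=; rewrite ?addn0// add1n.
by rewrite /minn; case: (ltnP (deg (del i E) v) M); case: (ltnP _.+1 M) => *; lia.
Qed.

(** At most [1 + deg E i] summands are affected outright. The remaining change, counted from the
    side of [v], is the total degree of the neighbours of [i] that have degree at most [M], hence at
    most [M * deg E i]. *)
Lemma trunc_sum_del E i : (0 < k)%N ->
  `|trunc_sum E - trunc_sum (del i E)| <=
  (1 + deg E i)%:R * (2 * ((k * M)%:R + `|K|) + M%:R).
Proof.
move=> k0; rewrite -sumrB (le_trans (ler_norm_sum _ _ _))//.
rewrite (le_trans (ler_sum _ (fun u _ => trunc_del E i u k0)))//.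
rewrite big_split/= -mulr_suml -natr_sum -natr_sum [leRHS]mulrDr lerD//.
  rewrite ler_wpM2r// ler_nat; apply: (@leq_trans #|i |: nb E i|).
    rewrite -sum1_card [leqRHS]big_mkcond; apply: leq_sum => u _.
    by rewrite !inE; case: ifP.
  by rewrite cardsU1 leq_add2r leq_b1.
rewrite -natrM ler_nat.
rewrite mulnDl mul1n; apply: leq_trans (leq_addl _ _).
rewrite (sum_deg_swap E (fun v => (v \in nb E i) && (deg E v <= M)%N)).
rewrite [X in (_ <= X * _)%N]/deg -sum_nat_const.
rewrite [leqRHS]big_mkcond; apply: leq_sum => v _; rewrite -/(deg E v).
case: (v \in nb E i) => //=.
by case: (leqP (deg E v) M) => dM; rewrite ?mul1n ?mul0n.
Qed.

End truncated_sum.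

(** Efron-Stein fed with [trunc_sum_del]; the factor [4 * (1 + q) ^+ n.-1] dominates the second
    moment of one plus a degree, by [expn2_sqr]. *)
Lemma var_trunc_sum k M K : (0 < k)%N ->
  Ex (fun E => trunc_sum k M K E ^+ 2) - Ex (trunc_sum k M K) ^+ 2 <=
  n%:R * ((2 * ((k * M)%:R + `|K|) + M%:R) ^+ 2 * (4 * (1 + q) ^+ n.-1)).
Proof.
move=> k0; rewrite (le_trans (rg_variance rg _))//.
rewrite mulr_natl -[X in _ *+ X](card_ord n) -sumr_const ler_sum// => i _.
rewrite -(Ex_exp2_deg i) -!ExZ le_Ex// => E.
set C := 2 * _ + _; have C0 : 0 <= C by rewrite addr_ge0// mulr_ge0// addr_ge0.
rewrite -real_normK ?num_real//.
apply: (@le_trans _ _ (((1 + deg E i)%:R * C) ^+ 2)).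
  by rewrite ler_pXn2r ?nnegrE ?mulr_ge0//; exact: trunc_sum_del.
rewrite exprMn mulrC ler_wpM2l ?sqr_ge0//.
by rewrite -natrX -[X in X * _]/(4%:R) -natrX -natrM ler_nat expn2_sqr.
Qed.

Definition full_sum k K E : R :=
  \sum_u (deg E u == k)%:R * ((nbdeg E u)%:R - K).

(** After exchanging the sums the excess is at most the sum over [v] of d (d - M)^+ with d the
    degree of [v], and M d (d - M)^+ <= d^3 <= 4 * 2^d. *)
Lemma full_sum_trunc k M K E :
  M%:R * `|full_sum k K E - trunc_sum k M K E| <= 4 * \sum_u 2 ^+ deg E u.
Proof.
rewrite -sumrB.
rewrite (eq_bigr (fun u => ((deg E u == k) * \sum_(v in nb E u) (deg E v - M))%:R)); last first.
  move=> u _; rewrite /trunc -mulrBr opprB addrA subrK natrM; congr (_ * _).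
  rewrite (_ : nbdeg E u = (\sum_(v in nb E u) minn (deg E v) M + \sum_(v in nb E u) (deg E v - M))%N).
    by rewrite natrD addrAC subrr add0r.
  by rewrite -big_split/=; apply: eq_bigr => v _; lia.
rewrite -natr_sum normr_nat -natrM.
rewrite (_ : 4 * _ = (4 * \sum_u 2 ^ deg E u)%:R); last first.
  by rewrite natrM natr_sum; congr (_ * _); apply: eq_bigr => u _; rewrite natrX.
rewrite ler_nat.
apply: (@leq_trans (M * \sum_u \sum_(v in nb E u) (deg E v - M))).
  rewrite leq_mul2l; apply/orP; right; apply: leq_sum => u _.
  by case: eqP; rewrite ?mul1n ?mul0n.
rewrite sum_deg_swap !big_distrr/=; apply: leq_sum => v _.
apply: leq_trans (expn2_cube _); move: (deg E v) => e.
rewrite !expnS expn0 muln1; have [/eqP ->|Me] := leqP e M; first by rewrite muln0.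
nia.
Qed.

Lemma Ex_full_sum k K : Ex (full_sum k.+1 K) =
  n%:R * ((k.+1%:R - K) * binpmf n.-1 k.+1 + (n.-1 * n.-2)%:R *
    (t * tri_pmf (n - 3) k + (q ^+ 2 - t) * binpmf (n - 3) k)).
Proof.
rewrite Ex_sum mulr_natl -[X in _ *+ X](card_ord n) -sumr_const; apply: eq_bigr => u _.
under eq_Ex do rewrite mulrBr mulrC [_ * K]mulrC.
rewrite ExB ExZ Ex_deg; under eq_Ex do rewrite mulrC.
by rewrite Ex_deg_nbdeg; ring.
Qed.

Definition count_deg k E : R := \sum_u (deg E u == k)%:R.

Lemma trunc_sum_count k E : trunc_sum k 0 (-1) E = count_deg k E.
Proof.
apply: eq_bigr => u _; rewrite /trunc big1 ?add0r ?opprK ?mulr1//.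
Qed.

Lemma Ex_count_deg k : Ex (count_deg k) = n%:R * binpmf n.-1 k.
Proof.
rewrite Ex_sum mulr_natl -[X in _ *+ X](card_ord n) -sumr_const.
by apply: eq_bigr => u _; exact: Ex_deg.
Qed.

Local Notation c4 := (4 * (1 + q) ^+ n.-1).

Lemma markov_Ex (B : pred es) f s : 0 < s -> (forall E, 0 <= f E) ->
  (forall E, B E -> s <= f E) -> \sum_(E | B E) pr E <= Ex f / s.
Proof.
move=> s0 f0 Bf; rewrite ler_pdivlMr// mulr_suml big_mkcond/=; apply: ler_sum => E _.
case: ifPn => BE; first by rewrite ler_wpM2l ?(rg_ge0 rg)// Bf.
by rewrite mulr_ge0// (rg_ge0 rg).
Qed.

Lemma Ex_sqr_dev f : Ex (fun E => (f E - Ex f) ^+ 2) = Ex (fun E => f E ^+ 2) - Ex f ^+ 2.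
Proof.
under eq_Ex do rewrite sqrrB.
rewrite ExD ExB Ex_cst (_ : Ex (fun E => f E * Ex f *+ 2) = 2 * Ex f * Ex f); first by ring.
by rewrite -ExZ; apply: eq_Ex => E; ring.
Qed.

(** Chebyshev: the mean is at least [delta * n], so the event is a deviation of at least
    [delta / 2 * n]. Of the factor 16, one 4 is the square of the influence constant 2 at [M = 0],
    [K = -1], and the other comes from halving [delta]. *)
Lemma prob_count_deg k delta : (0 < n)%N -> (0 < k)%N -> 0 < delta ->
  delta <= binpmf n.-1 k ->
  \sum_(E | count_deg k E <= delta / 2 * n%:R) pr E <= 16 * c4 / (delta ^+ 2 * n%:R).
Proof.
move=> n0 k0 d0 db; have n0' : 0 < n%:R :> R by rewrite ltr0n.
have := @var_trunc_sum k 0 (-1) k0; rewrite -Ex_sqr_dev.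
rewrite muln0 normrN normr1 add0r addr0 mulr1.
under eq_Ex do rewrite trunc_sum_count.
rewrite (_ : Ex (trunc_sum k 0 (-1)) = n%:R * binpmf n.-1 k); last first.
  by rewrite -Ex_count_deg; apply: eq_Ex => E; rewrite trunc_sum_count.
set b := _ * binpmf _ _ => var.
have s0 : 0 < (delta / 2 * n%:R) ^+ 2 by rewrite exprn_gt0// mulr_gt0// divr_gt0.
apply: (le_trans (markov_Ex (f := fun E => (count_deg k E - b) ^+ 2) s0 _ _)).
- by move=> E; exact: sqr_ge0.
- move=> E cE; rewrite -[leRHS]sqrrN opprB.
  have h0 : 0 <= delta / 2 * n%:R by rewrite mulr_ge0// divr_ge0// ltW.
  have h : delta / 2 * n%:R <= b - count_deg k E.
    rewrite lerBrDr (le_trans (lerD (lexx _) cE))// /b -mulrDl -splitr mulrC.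
    by rewrite ler_pM2l.
  by rewrite ler_pXn2r ?nnegrE// (le_trans h0 h).
rewrite ler_pdivrMr// (le_trans var)// le_eqVlt; apply/orP; left; apply/eqP.
by field; rewrite ?gt_eqF.
Qed.

(** Markov's inequality for the split [(f - g) + (g - Ex g) + Ex g], with [g] the truncated sum. The
    truncation error is paid twice: directly, and when [Ex g] is compared with [Ex f]. The middle
    term is bounded by the variance through the arithmetic-geometric mean inequality at the free
    scale [zeta * n], which avoids a square root. *)
Lemma prob_full_sum k M K eta zeta : (0 < n)%N -> (0 < k)%N -> (0 < M)%N ->
  0 < eta -> 0 < zeta ->
  \sum_(E | eta * n%:R < `|full_sum k K E|) pr E <=
  (`|Ex (full_sum k K)| / n%:R + 2 * c4 / M%:R +
   ((2 * ((k * M)%:R + `|K|) + M%:R) ^+ 2 * c4 / (zeta * n%:R) + zeta) / 2) / eta.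
Proof.
move=> n0 k0 M0 e0 z0; have n0' : 0 < n%:R :> R by rewrite ltr0n.
have M0' : 0 < M%:R :> R by rewrite ltr0n.
set C := (_ + _) ^+ 2.
have var := var_trunc_sum M K k0; rewrite -Ex_sqr_dev -/C in var.
set f := full_sum k K; set g := trunc_sum k M K in var *.
have fg : Ex (fun E => `|f E - g E|) <= n%:R * (c4 / M%:R).
  rewrite -(ler_pM2l M0') -ExZ (le_trans (le_Ex (fun E => full_sum_trunc k M K E)))//.
  rewrite ExZ Ex_sum (eq_bigr _ (fun u _ => Ex_exp2_deg u)) sumr_const card_ord -mulr_natr.
  by rewrite le_eqVlt; apply/orP; left; apply/eqP; field; rewrite ?gt_eqF.
have gE : Ex (fun E => `|g E - Ex g|) <= n%:R * ((C * c4 / (zeta * n%:R) + zeta) / 2).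
  apply: (@le_trans _ _ (Ex (fun E => ((g E - Ex g) ^+ 2 * (zeta * n%:R)^-1 + zeta * n%:R) / 2))).
    apply: le_Ex => E; set x := g E - _; have s0 : 0 < zeta * n%:R by rewrite mulr_gt0.
    rewrite ler_pdivlMr// -(ler_pM2r s0) [leRHS]mulrDl divfK ?gt_eqF//.
    have := sqr_ge0 (`|x| - zeta * n%:R); rewrite sqrrB real_normK ?num_real//.
    by move=> h; rewrite -subr_ge0; apply: le_trans h _; rewrite le_eqVlt; apply/orP; left; apply/eqP; ring.
  rewrite (_ : Ex _ = (Ex (fun E => (g E - Ex g) ^+ 2) * (zeta * n%:R)^-1 + zeta * n%:R) / 2).
    rewrite (_ : n%:R * _ = (n%:R * (C * c4) * (zeta * n%:R)^-1 + zeta * n%:R) / 2); last first.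
      by field; rewrite ?gt_eqF.
    by rewrite ler_wpM2r// lerD2r ler_wpM2r// invr_ge0 mulr_ge0// ltW.
  transitivity (Ex (fun E => 2^-1 * ((zeta * n%:R)^-1 * (g E - Ex g) ^+ 2 + zeta * n%:R))).
    by apply: eq_Ex => E; rewrite mulrC [X in X + _]mulrC.
  by rewrite ExZ ExD ExZ Ex_cst mulrC [X in X + _]mulrC.
have Eg : `|Ex g| <= `|Ex f| + n%:R * (c4 / M%:R).
  rewrite -[X in `|X|](subrK (Ex f)) addrC (le_trans (ler_normD _ _))// lerD2l.
  rewrite (le_trans _ fg)// distrC -ExB (le_trans (ler_norm_sum _ _ _))//.
  by apply: ler_sum => E _; rewrite normrM ger0_norm ?(rg_ge0 rg).
have s0 : 0 < eta * n%:R by rewrite mulr_gt0.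
apply: (le_trans (markov_Ex (f := fun E => `|f E|) s0 _ _)) => //; first by move=> E /ltW.
rewrite ler_pdivrMr// [leRHS]mulrA divfK ?gt_eqF//.
apply: (@le_trans _ _ (Ex (fun E => `|f E - g E|) + Ex (fun E => `|g E - Ex g|) + `|Ex g|)).
  rewrite -(Ex_cst `|Ex g|) -!ExD; apply: le_Ex => E.
  rewrite -[X in `|X| <= _](subrK (g E)) -[X in `|_ + X|](subrK (Ex g)) addrA.
  by rewrite (le_trans (ler_normD _ _))// lerD// ler_normD.
rewrite (le_trans (lerD (lerD fg gE) Eg))// le_eqVlt; apply/orP; left; apply/eqP.
by field; rewrite ?gt_eqF.
Qed.

End graph_law.

(** * Product measures and the Efron-Stein inequality *)

Local Open Scope classical_set_scope.
Local Open Scope ring_scope.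

Section tuple_measures.
Context {d} {T : measurableType d} {R : realType}.

Definition rectangle n (A : 'I_n -> set T) : set (n.-tuple T) :=
  [set x | forall i, A i (tnth x i)].

Lemma measurable_rectangle n (A : 'I_n -> set T) :
  (forall i, measurable (A i)) -> measurable (rectangle A).
Proof.
move=> mA; rewrite (_ : rectangle A =
    \bigcap_(i in setT) (fun x => tnth x i) @^-1` A i).
  apply: fin_bigcap_measurable => // i _.
  by rewrite -[X in measurable X]setTI; exact: measurable_tnth.
by apply/seteqP; split => [x Ax i _|x Ax i]; exact: Ax.
Qed.

(** Rectangles are stable under intersection and generate the product sigma-algebra. The exhaustion
    [g] covers measures of infinite mass such as [volume]. *)
Lemma tuple_measure_unique n (m1 m2 : {measure set (n.-tuple T) -> \bar R})
    (g : nat -> 'I_n -> set T) :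
  (forall k i, measurable (g k i)) -> \bigcup_k rectangle (g k) = setT ->
  (forall k, m1 (rectangle (g k)) < +oo)%E ->
  (forall A, (forall i, measurable (A i)) ->
    m1 (rectangle A) = m2 (rectangle A)) ->
  forall B, measurable B -> m1 B = m2 B.
Proof.
move=> mg gT m1oo m12.
pose G : set (set (n.-tuple T)) :=
  [set C | exists2 A, (forall i, measurable (A i)) & C = rectangle A].
apply: (measure_unique G (fun k => rectangle (g k))) => //.
- apply/seteqP; split; last first.
    apply: smallest_sub; first exact: sigma_algebra_measurable.
    by move=> _ [A mA ->]; exact: measurable_rectangle.
  apply: smallest_sub; first exact: smallest_sigma_algebra.
  rewrite -bigcup_seq => C [i /= _ [A mA <-]]; rewrite setTI.
  apply: sub_sigma_algebra.
  exists (fun j => if j == i then A else setT); first by move=> j; case: ifP.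
  apply/seteqP; split => [x Ax j|x /(_ i)]; last by rewrite eqxx.
  by case: eqP => // ->.
- move=> _ _ [A mA ->] [B mB ->]; exists (fun i => A i `&` B i).
    by move=> i; exact: measurableI.
  by apply/seteqP; split => [x [Ax Bx] i|x ABx]; [split|split => i; case: (ABx i)].
- by move=> k; exists (g k).
- by move=> _ [A mA ->]; exact: m12.
Qed.

Lemma finite_tuple_measure_unique n (m1 m2 : {measure set (n.-tuple T) -> \bar R}) :
  (m1 setT < +oo)%E ->
  (forall A, (forall i, measurable (A i)) ->
    m1 (rectangle A) = m2 (rectangle A)) ->
  forall B, measurable B -> m1 B = m2 B.
Proof.
move=> m1oo m12.
have rT : rectangle (fun _ : 'I_n => [set: T]) = setT by apply/seteqP; split.
apply: (@tuple_measure_unique n m1 m2 (fun=> fun=> setT)) => //.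
  by rewrite rT bigcup_const//; exists 0%N.
by move=> _; rewrite rT.
Qed.

Definition tcons n (z : T * n.-tuple T) : n.+1.-tuple T := [tuple of z.1 :: z.2].

Lemma measurable_tcons n : measurable_fun setT (@tcons n).
Proof. exact: measurable_cons. Qed.

HB.instance Definition _ n :=
  isMeasurableFun.Build _ _ _ _ (@tcons n) (@measurable_tcons n).

Lemma tnth_tcons0 n (z : T * n.-tuple T) : tnth (tcons z) ord0 = z.1.
Proof. by []. Qed.

Lemma tnth_tconsS n (z : T * n.-tuple T) i : tnth (tcons z) (lift ord0 i) = tnth z.2 i.
Proof. by rewrite (tnth_nth z.1) /= -tnth_nth. Qed.

(** Built by prepending coordinates, like [volume], so that Fubini peels off coordinate 0. *)
Fixpoint power (mu : probability T R) n : probability (n.-tuple T) R :=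
  match n with
  | 0 => \d_[tuple]
  | n'.+1 => distribution (mu \x power mu n')%E (@tcons n')
  end.

Lemma power_rectangle (mu : probability T R) n (A : 'I_n -> set T) :
  (forall i, measurable (A i)) ->
  power mu n (rectangle A) = (\prod_(i < n) mu (A i))%E.
Proof.
elim: n A => [|n IH] A mA; first by rewrite big_ord0 /= diracE mem_set//= => -[].
rewrite big_ord_recl /= -IH// -product_measure1E//; last exact: measurable_rectangle.
rewrite /distribution /pushforward; congr (product_measure1 _ _ _).
apply/seteqP; split => -[x y] /=.
  move=> H; split; first exact: (H ord0).
  by move=> i; have := H (lift ord0 i); rewrite tnth_tconsS.
move=> [Hx Hy] i; have [j ->|->] := unliftP ord0 i; last exact: Hx.
by rewrite tnth_tconsS; exact: Hy.
Qed.

End tuple_measures.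

Lemma in_setE_bool T (b : T -> bool) x : (x \in [set x | b x]) = b x.
Proof. by apply/idP/idP => [/set_mem|/mem_set]. Qed.

Lemma probability_lty d (T : measurableType d) (R : realType) (P : probability T R) :
  (P setT < +oo)%E.
Proof. by rewrite probability_setT ltry. Qed.

(** * Expectations of bounded measurable functions and Efron-Stein *)

Section bounded_measurable.
Context {R : realType}.

(** A class stable under the operations below and integrable for every probability, which is all
    that linearity and Fubini ask for. *)
Definition bmeas d (T : measurableType d) (f : T -> R) :=
  measurable_fun setT f /\ exists M, forall x, `|f x| <= M.

Section lemmas.
Context d (T : measurableType d).
Implicit Types f g : T -> R.

Lemma bmeas_cst c : bmeas (fun _ : T => c).
Proof. by split; [exact: measurable_cst|exists `|c|]. Qed.

Lemma bmeasD f g : bmeas f -> bmeas g -> bmeas (fun x => f x + g x).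
Proof.
move=> [mf [M fM]] [mg [N gN]]; split; first exact: measurable_funD.
by exists (M + N) => x; rewrite (le_trans (ler_normD _ _))// lerD.
Qed.

Lemma bmeasM f g : bmeas f -> bmeas g -> bmeas (fun x => f x * g x).
Proof.
move=> [mf [M fM]] [mg [N gN]]; split; first exact: measurable_funM.
by exists (M * N) => x; rewrite normrM ler_pM.
Qed.

Lemma bmeasZ c f : bmeas f -> bmeas (fun x => c * f x).
Proof. by apply: bmeasM; exact: bmeas_cst. Qed.

Lemma bmeasN f : bmeas f -> bmeas (fun x => - f x).
Proof. by move=> /(bmeasZ (-1)); under eq_fun do rewrite mulN1r. Qed.

Lemma bmeasB f g : bmeas f -> bmeas g -> bmeas (fun x => f x - g x).
Proof. by move=> bf bg; apply: bmeasD => //; exact: bmeasN. Qed.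

Lemma bmeasX n f : bmeas f -> bmeas (fun x => f x ^+ n).
Proof.
move=> bf; elim: n => [|n IH]; first by under eq_fun do rewrite expr0; exact: bmeas_cst.
by under eq_fun do rewrite exprS; exact: bmeasM.
Qed.

Lemma bmeas_prod (I : Type) (s : seq I) (P : pred I) (F : I -> T -> R) :
  (forall i, P i -> bmeas (F i)) -> bmeas (fun x => \prod_(i <- s | P i) F i x).
Proof.
move=> bF; elim: s => [|i s IH].
  by under eq_fun do rewrite big_nil; exact: bmeas_cst.
case: (boolP (P i)) => Pi.
  by under eq_fun do rewrite big_cons Pi; apply: bmeasM => //; exact: bF.
by under eq_fun do rewrite big_cons (negbTE Pi).
Qed.

Lemma bmeas_bool (b : T -> bool) :
  measurable [set x | b x] -> bmeas (fun x => (b x)%:R).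
Proof.
move=> mb; split; last by exists 1 => x; case: (b x); rewrite ?normr1 ?normr0.
rewrite (_ : (fun _ => _) = \1_[set x | b x]); first exact: measurable_indic.
by apply/funext => x; rewrite indicE in_setE_bool.
Qed.

Lemma bmeas_comp d' (T' : measurableType d') (f : T' -> R) (h : T -> T') :
  measurable_fun setT h -> bmeas f -> bmeas (fun x => f (h x)).
Proof. by move=> mh [mf [M fM]]; split; [exact: measurableT_comp|exists M]. Qed.

Lemma bmeas_integrable (mu : probability T R) f :
  bmeas f -> mu.-integrable setT (EFin \o f).
Proof.
move=> [mf [M fM]]; apply: measurable_bounded_integrable => //.
  by rewrite (@le_lt_trans _ _ 1%E) ?ltry// probability_le1.
exists M; split; first exact: num_real.
by move=> N MN x _; exact: le_trans (fM x) (ltW MN).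
Qed.

End lemmas.

Section expectation.
Context d (T : measurableType d) (mu : probability T R).
Implicit Types f g : T -> R.

Lemma mean_cst c : \int[mu]_(_ in setT) c = c.
Proof.
transitivity (c * fine (mu setT)); first exact: Rintegral_cst.
by rewrite probability_setT mulr1.
Qed.

Lemma meanD f g : bmeas f -> bmeas g ->
  \int[mu]_x (f x + g x) = \int[mu]_x f x + \int[mu]_x g x.
Proof. by move=> bf bg; rewrite RintegralD//; exact: bmeas_integrable. Qed.

Lemma meanB f g : bmeas f -> bmeas g ->
  \int[mu]_x (f x - g x) = \int[mu]_x f x - \int[mu]_x g x.
Proof. by move=> bf bg; rewrite RintegralB//; exact: bmeas_integrable. Qed.

Lemma meanZ c f : bmeas f -> \int[mu]_x (c * f x) = c * \int[mu]_x f x.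
Proof. by move=> bf; rewrite RintegralZl//; exact: bmeas_integrable. Qed.

Lemma le_mean f g : bmeas f -> bmeas g -> (forall x, f x <= g x) ->
  \int[mu]_x f x <= \int[mu]_x g x.
Proof. by move=> bf bg fg; apply: le_Rintegral => //; exact: bmeas_integrable. Qed.

Lemma mean_sum (I : Type) (s : seq I) (P : pred I) (F : I -> T -> R) :
  (forall i, P i -> bmeas (F i)) ->
  bmeas (fun x => \sum_(i <- s | P i) F i x) /\
  \int[mu]_x (\sum_(i <- s | P i) F i x) = \sum_(i <- s | P i) \int[mu]_x F i x.
Proof.
move=> bF; elim: s => [|i s [IHb IH]].
  rewrite (_ : (fun x => _) = cst 0); last by apply/funext => x; rewrite big_nil.
  by rewrite big_nil mean_cst; split => //; exact: bmeas_cst.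
rewrite (_ : (fun x => _) = fun x => (if P i then F i x else 0) +
    \sum_(i <- s | P i) F i x); last first.
  by apply/funext => x; rewrite big_cons; case: ifP => // _; rewrite add0r.
rewrite big_cons; case: ifP => Pi.
  by split; [apply: bmeasD => //; exact: bF|rewrite meanD ?IH//; exact: bF].
rewrite (_ : (fun x => _) = fun x => \sum_(i <- s | P i) F i x) ?IH//.
by apply/funext => x; rewrite add0r.
Qed.

Lemma mean_bool (b : T -> bool) : measurable [set x | b x] ->
  \int[mu]_x (b x)%:R = fine (mu [set x | b x]).
Proof.
move=> mb; rewrite -[in RHS](setIT [set x | b x]) -integral_indic//.
by congr fine; apply: eq_integral => x _; rewrite indicE in_setE_bool.
Qed.

Lemma sqr_mean_le f : bmeas f -> (\int[mu]_x f x) ^+ 2 <= \int[mu]_x (f x ^+ 2).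
Proof.
move=> bf; set c := \int[mu]_x f x.
have : 0 <= \int[mu]_x ((f x - c) ^+ 2).
  by apply: Rintegral_ge0 => x _; exact: sqr_ge0.
rewrite (_ : (fun x => (f x - c) ^+ 2) =
    (fun x => f x ^+ 2 - (2 * c * f x - c ^+ 2))); last by apply/funext => x; ring.
have b1 : bmeas (fun x => 2 * c * f x) by exact: bmeasZ.
have b2 : bmeas (fun _ : T => c ^+ 2) by exact: bmeas_cst.
rewrite meanB; [|exact: bmeasX|exact: bmeasB].
by rewrite meanB// meanZ// mean_cst -/c; lra.
Qed.

Lemma mean_norm_le f M :
  bmeas f -> (forall x, `|f x| <= M) -> `|\int[mu]_x f x| <= M.
Proof.
move=> bf fM; rewrite (le_trans (le_normr_Rintegral _ _))//; first exact: bmeas_integrable.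
rewrite -[leRHS](mean_cst); apply: le_mean => //; last exact: bmeas_cst.
by split; [apply: measurableT_comp => //; case: bf|exists M => x; rewrite normr_id].
Qed.

End expectation.

Section fubini.
Context d1 d2 (T1 : measurableType d1) (T2 : measurableType d2).
Variables (mu : probability T1 R) (nu : probability T2 R).

Lemma bmeas_pair1 (f : T1 * T2 -> R) x : bmeas f -> bmeas (fun y => f (x, y)).
Proof. by apply: bmeas_comp; exact: pair1_measurable. Qed.

Lemma bmeas_pair2 (f : T1 * T2 -> R) y : bmeas f -> bmeas (fun x => f (x, y)).
Proof. by apply: bmeas_comp; exact: pair2_measurable. Qed.

Lemma bmeas_mean2 (f : T1 * T2 -> R) : bmeas f ->
  bmeas (fun x => \int[nu]_y f (x, y)).
Proof.
move=> bf; have [mf [M fM]] := bf; split.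
  apply: (@measurableT_comp _ _ _ _ _ _ _ _ (fubini_F nu (EFin \o f))); first exact: fine_measurable.
  exact/measurable_fubini_F/bmeas_integrable.
by exists M => x; apply: mean_norm_le => //; exact: bmeas_pair1.
Qed.

Lemma mean_prod (f : T1 * T2 -> R) : bmeas f ->
  \int[(mu \x nu)%E]_z f z = \int[mu]_x \int[nu]_y f (x, y).
Proof.
move=> bf; rewrite /Rintegral -integral12_prod_meas1//; last exact: bmeas_integrable.
congr fine; apply: eq_integral => x _; rewrite fineK//.
by apply: integrable_fin_num => //; apply: bmeas_integrable; exact: bmeas_pair1.
Qed.

Lemma mean_swap (f : T1 * T2 -> R) : bmeas f ->
  \int[mu]_x \int[nu]_y f (x, y) = \int[nu]_y \int[mu]_x f (x, y).
Proof.
move=> bf; rewrite -mean_prod// /Rintegral -integral21_prod_meas1//; last exact: bmeas_integrable.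
congr fine; apply: eq_integral => x _; rewrite fineK//.
by apply: integrable_fin_num => //; apply: bmeas_integrable; exact: bmeas_pair2.
Qed.

End fubini.

Lemma mean_distribution d d' (T : measurableType d) (T' : measurableType d')
    (P : probability T R) (X : {mfun T >-> T'}) (f : T' -> R) : bmeas f ->
  \int[distribution P X]_y f y = \int[P]_x f (X x).
Proof.
move=> bf; congr fine.
rewrite integral_pushforward//; first exact/measurable_EFinP/(proj1 bf).
by rewrite preimage_setT; apply/bmeas_integrable/bmeas_comp.
Qed.

Lemma mean_ext d (T : measurableType d) (m1 m2 : probability T R) (f : T -> R) :
  (forall A, measurable A -> m1 A = m2 A) -> \int[m1]_x f x = \int[m2]_x f x.
Proof. by move=> m12; congr fine; apply: eq_measure_integral => A mA _; exact: m12. Qed.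

Lemma mean_powerS d (T : measurableType d) (mu : probability T R) n
    (f : n.+1.-tuple T -> R) : bmeas f ->
  \int[power mu n.+1]_x f x = \int[mu]_x \int[power mu n]_y f (tcons (x, y)).
Proof.
move=> bf; rewrite mean_distribution// (mean_prod _ _ (f := f \o @tcons _ _ n))//.
by apply: bmeas_comp.
Qed.

Lemma mean_power0 d (T : measurableType d) (mu : probability T R)
    (f : 0.-tuple T -> R) : \int[power mu 0]_x f x = f [tuple].
Proof.
rewrite (_ : f = fun=> f [tuple]) ?mean_cst//.
by apply/funext => x; rewrite tuple0.
Qed.

(** Induction through the law of total variance in coordinate 0. The conditional variances fall
    under the induction hypothesis. The variance of the conditional mean [m] is at most its
    quadratic deviation from the mean [c] of [g ord0], which is the same for all values of
    coordinate 0, and Jensen compares this with [f - g ord0]. Allowing any [g i] blind to coordinate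
    [i] is what admits vertex deletions. *)
Lemma efron_stein d (T : measurableType d) (mu : probability T R) n
    (f : n.-tuple T -> R) (g : 'I_n -> n.-tuple T -> R) :
  bmeas f -> (forall i, bmeas (g i)) ->
  (forall i x y, (forall j, j != i -> tnth x j = tnth y j) -> g i x = g i y) ->
  \int[power mu n]_x (f x ^+ 2) - (\int[power mu n]_x f x) ^+ 2 <=
  \sum_(i < n) \int[power mu n]_x ((f x - g i x) ^+ 2).
Proof.
elim: n f g => [|n IH] f g bf bg gE.
  by rewrite big_ord0 !mean_power0 subrr.
have bc (h : n.+1.-tuple T -> R) x : bmeas h -> bmeas (fun y => h (tcons (x, y)) : R).
  move=> bh; apply: (bmeas_comp (h := fun y => tcons (x, y))) => //.
  by apply: (measurableT_comp (@measurable_tcons _ _ _)); exact: pair1_measurable.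
have bp (h : n.+1.-tuple T -> R) : bmeas h -> bmeas (fun x => \int[power mu n]_y h (tcons (x, y))).
  by move=> bh; apply: (bmeas_mean2 mu (power mu n) (f := h \o @tcons _ _ n)); exact: bmeas_comp.
rewrite mean_powerS; last exact: bmeasX.
rewrite mean_powerS// big_ord_recl.
pose V x := \int[power mu n]_y (f (tcons (x, y)) ^+ 2) -
            (\int[power mu n]_y f (tcons (x, y))) ^+ 2.
pose m x := \int[power mu n]_y f (tcons (x, y)).
have bV : bmeas V by apply: bmeasB; [exact/(bp (fun z => f z ^+ 2))/bmeasX|exact/bmeasX/bp].
have bm : bmeas m by exact: bp.
have -> : \int[mu]_x \int[power mu n]_y (f (tcons (x, y)) ^+ 2) =
    \int[mu]_x V x + \int[mu]_x (m x ^+ 2).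
  rewrite -meanD//; last exact: bmeasX.
  by apply: eq_Rintegral => x _; rewrite /V /m subrK.
have VE : \int[mu]_x V x <= \sum_(i < n) \int[power mu n.+1]_x
    ((f x - g (lift ord0 i) x) ^+ 2).
  apply: (@le_trans _ _ (\int[mu]_x \sum_(i < n) \int[power mu n]_y
      ((f (tcons (x, y)) - g (lift ord0 i) (tcons (x, y))) ^+ 2))).
    apply: le_mean => //.
      apply: (proj1 (mean_sum mu _ _)) => i _.
      by apply: (bp (fun z => (f z - g (lift ord0 i) z) ^+ 2)); exact/bmeasX/bmeasB.
    move=> x; apply: (IH (fun y => f (tcons (x, y)))
        (fun i y => g (lift ord0 i) (tcons (x, y)))).
    - exact: bc.
    - by move=> i; exact: bc.
    - move=> i y z yz; apply: gE => j ji.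
      have [k jk|->//] := unliftP ord0 j.
      by rewrite jk !tnth_tconsS yz//; apply: contra_neq ji => <-.
  rewrite (proj2 (mean_sum mu _ _)).
    by apply: ler_sum => i _; rewrite mean_powerS//; exact/bmeasX/bmeasB.
  move=> i _; apply: (bp (fun z => (f z - g (lift ord0 i) z) ^+ 2)).
  exact/bmeasX/bmeasB.
(* A space carrying a probability is inhabited; any point serves to name the constant [c]. *)
have [x0] : exists x0 : T, True.
  apply: contrapT => /forallNP h; have := @probability_setT _ _ _ mu.
  rewrite (_ : setT = set0); first by rewrite measure0 => /eqP; rewrite eq_sym onee_eq0.
  by apply/seteqP; split => // x _; exact: h.
move=> _; pose c := \int[power mu n]_y g ord0 (tcons (x0, y)).
have cE x : \int[power mu n]_y g ord0 (tcons (x, y)) = c.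
  apply: eq_Rintegral => y _; apply: gE => j.
  by have [k ->|->//] := unliftP ord0 j; rewrite !tnth_tconsS.
have mE : \int[mu]_x (m x ^+ 2) - (\int[mu]_x m x) ^+ 2 <=
    \int[power mu n.+1]_x ((f x - g ord0 x) ^+ 2).
  rewrite mean_powerS; last exact/bmeasX/bmeasB.
  apply: (@le_trans _ _ (\int[mu]_x ((m x - c) ^+ 2))).
    set a := \int[mu]_x m x.
    suff -> : \int[mu]_x ((m x - c) ^+ 2) =
      \int[mu]_x (m x ^+ 2) - 2 * c * a + c ^+ 2 by have := sqr_ge0 (a - c); lra.
    rewrite (_ : (fun x => (m x - c) ^+ 2) =
      (fun x => m x ^+ 2 - 2 * c * m x + c ^+ 2)); last by apply/funext => x; ring.
    have b1 : bmeas (fun x => 2 * c * m x) by exact: bmeasZ.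
    have b2 : bmeas (fun x => m x ^+ 2) by exact: bmeasX.
    rewrite meanD; [|exact: bmeasB|exact: bmeas_cst].
    by rewrite meanB// meanZ// mean_cst.
  apply: le_mean; first exact/bmeasX/bmeasB/bmeas_cst.
    by apply: (bp (fun z => (f z - g ord0 z) ^+ 2)); exact/bmeasX/bmeasB.
  move=> x; rewrite -(cE x) /m -meanB; [|exact: bc|exact: bc].
  apply: sqr_mean_le; apply: (bc (fun z => f z - g ord0 z)); exact: bmeasB.
by rewrite -addrA addrC lerD.
Qed.

Section integrate_out.
Context d (T : measurableType d) (mu : probability T R).

Definition upd n (i : 'I_n) (z : n.-tuple T * T) : n.-tuple T :=
  [tuple if j == i then z.2 else tnth z.1 j | j < n].

Lemma tnth_upd n (i : 'I_n) z j :
  tnth (upd i z) j = if j == i then z.2 else tnth z.1 j.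
Proof. by rewrite tnth_mktuple. Qed.

Lemma measurable_upd n (i : 'I_n) : measurable_fun setT (upd i).
Proof.
apply/measurable_fun_tnthP => j.
rewrite (_ : _ \o _ = fun z => if j == i then z.2 else tnth z.1 j).
  case: eqP => _; first exact: measurable_snd.
  exact: measurableT_comp (@measurable_tnth _ T n j) (@measurable_fst _ _ (n.-tuple T) T).
by apply/funext => z /=; rewrite tnth_upd.
Qed.

HB.instance Definition _ n (i : 'I_n) :=
  isMeasurableFun.Build _ _ _ _ (@upd n i) (@measurable_upd n i).

(** Resampling a coordinate preserves the product law: this is Fubini for a chosen coordinate
    instead of the first. *)
Lemma mean_power_upd n (i : 'I_n) (f : n.-tuple T -> R) : bmeas f ->
  \int[power mu n]_x f x = \int[power mu n]_x \int[mu]_y f (upd i (x, y)).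
Proof.
move=> bf; rewrite -(mean_prod _ _ (f := fun z => f (upd i z))); last exact: bmeas_comp.
rewrite -(mean_distribution _ (upd i))//; apply: mean_ext.
apply: finite_tuple_measure_unique; first exact: probability_lty.
move=> A mA; transitivity (\prod_(j < n) mu (A j))%E; first exact: power_rectangle.
rewrite (bigD1 i)//= muleC /distribution /pushforward.
rewrite [X in product_measure1 _ _ X](_ : _ =
    rectangle (fun j => if j == i then setT else A j) `*` A i).
  rewrite product_measure1E//; last by apply: measurable_rectangle => j; case: ifP.
  congr (_ * _)%E; transitivity (\prod_(j < n) mu (if j == i then setT else A j))%E; last first.
    by apply/esym/power_rectangle => j; case: ifP.
  rewrite [RHS](bigD1 i)//= eqxx probability_setT mul1e.
  by apply: eq_bigr => j /negbTE ->.
apply/seteqP; split => -[x y] /=.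
  move=> H; split; last by have := H i; rewrite tnth_upd eqxx.
  by move=> j; have := H j; rewrite tnth_upd; case: ifP.
move=> [Hx Hy] j; have := Hx j; rewrite tnth_upd; case: eqP => //= -> _.
exact: Hy.
Qed.

End integrate_out.

End bounded_measurable.

(** * The independent-coin model of the edge set *)

Section finite_laws.
Context {R : realType}.

Section law.
Context d (W : measurableType d) (P : probability W R) (F : finType) (h : W -> F).
Hypothesis mh : forall c, measurable [set w | h w == c].

Definition law (c : F) : R := fine (P [set w | h w == c]).

Lemma law_ge0 c : 0 <= law c.
Proof. exact/fine_ge0/measure_ge0. Qed.

Lemma finval_sum (f : F -> R) w : f (h w) = \sum_c f c * (h w == c)%:R.
Proof.
rewrite (bigD1 (h w))//= eqxx mulr1 big1 ?addr0// => c /negbTE.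
by rewrite eq_sym => ->; rewrite mulr0.
Qed.

Lemma bmeas_finval (f : F -> R) : bmeas (fun w => f (h w)).
Proof.
rewrite (_ : (fun _ => _) = fun w => \sum_c f c * (h w == c)%:R).
  by apply: (proj1 (mean_sum P _ _)) => c _; exact/bmeasZ/bmeas_bool.
by apply/funext => w; exact: finval_sum.
Qed.

Lemma mean_finval (f : F -> R) : \int[P]_w f (h w) = \sum_c law c * f c.
Proof.
rewrite (_ : (fun _ => _) = fun w => \sum_c f c * (h w == c)%:R); last first.
  by apply/funext => w; exact: finval_sum.
rewrite (proj2 (mean_sum P _ _)); last by move=> c _; exact/bmeasZ/bmeas_bool.
by apply: eq_bigr => c _; rewrite meanZ ?mean_bool 1?mulrC//; exact: bmeas_bool.
Qed.

Lemma measurable_finval (B : pred F) : measurable [set w | B (h w)].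
Proof.
rewrite (_ : [set w | _] = \bigcup_(c in [set c | B c]) [set w | h w == c]).
  by apply: fin_bigcup_measurable.
apply/seteqP; split => [w Bw|w [c Bc /eqP hc]]; first by exists (h w) => /=.
by rewrite /= hc.
Qed.

Lemma law_event (B : pred F) : P [set w | B (h w)] = (\sum_(c | B c) law c)%:E.
Proof.
rewrite -[LHS]fineK; last exact/fin_num_measure/measurable_finval.
rewrite -mean_bool; last exact: measurable_finval.
rewrite (mean_finval (fun c => (B c)%:R)) [in RHS]big_mkcond; congr EFin.
by apply: eq_bigr => c _; case: (B c); rewrite ?mulr1 ?mulr0.
Qed.

End law.

Lemma measurable_forall d (W : measurableType d) (I : finType) (b : I -> W -> bool) :
  (forall i, measurable [set w | b i w]) -> measurable [set w | [forall i, b i w]].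
Proof.
move=> mb; rewrite (_ : [set w | _] = \bigcap_(i in setT) [set w | b i w]).
  exact: fin_bigcap_measurable.
by apply/seteqP; split => [w /forallP bw i _|w bw]; [exact: bw|apply/forallP => i; exact: bw].
Qed.

Lemma measurable_eqset d (W : measurableType d) (I : finType) (h : W -> {set I}) E :
  (forall i, measurable [set w | i \in h w]) -> measurable [set w | h w == E].
Proof.
move=> mh; rewrite (_ : [set w | _] = [set w | [forall i, (i \in h w) == (i \in E)]]).
  apply: measurable_forall => i; case: (boolP (i \in E)) => iE.
    by under eq_set do rewrite eqb_id; exact: mh.
  under eq_set do rewrite eqbF_neg.
  rewrite (_ : [set w | _] = ~` [set w | i \in h w]); first exact/measurableC/mh.
  by apply/seteqP; split => w /= /negP.
apply/seteqP; split => [w /= /eqP ->|w /= /forallP H].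
  by apply/forallP => i.
by apply/eqP/setP => i; apply/eqP.
Qed.

(** Moebius inversion as a downward induction: at [A] all strict supersets already agree, so their
    terms cancel. *)
Lemma upset_sum_inj (I : finType) (a b : {set I} -> R) :
  (forall A : {set I}, \sum_(E : {set I} | A \subset E) a E =
     \sum_(E : {set I} | A \subset E) b E) ->
  a =1 b.
Proof.
move=> ab A; move: {2}(#|~: A|.+1) (ltnSn #|~: A|) => m.
elim: m A => // m IH A Am; have := ab A.
rewrite (bigD1 A)//= [in X in _ = X -> _](bigD1 A)//=.
rewrite (eq_bigr b); first by move/addIr.
move=> E /andP[AE EA]; apply: IH.
apply: leq_trans (Am : (#|~: A| <= m)%N); apply: proper_card.
by rewrite properE !finset.setCS AE; apply: contra EA => EA; rewrite finset.eqEsubset EA.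
Qed.

End finite_laws.

(** Positions may interact through [Phi], whereas the marks enter by one factor per vertex and so
    integrate out separately. *)
Lemma mean_power_pair {R : realType} d d' (T : measurableType d) (C : measurableType d')
    (mu : probability T R) (k : probability C R) m
    (Phi : m.-tuple T -> R) (psi : 'I_m -> C -> R) :
  bmeas Phi -> (forall i, bmeas (psi i)) ->
  \int[power (mu \x k)%E m]_s
    (Phi [tuple (tnth s i).1 | i < m] * \prod_(i < m) psi i (tnth s i).2) =
  \int[power mu m]_x Phi x * \prod_(i < m) \int[k]_c psi i c.
Proof.
have mfst j : measurable_fun setT
    (fun s : j.-tuple (T * C) => [tuple (tnth s i).1 | i < j]).
  apply/measurable_fun_tnthP => i.
  rewrite (_ : _ \o _ = fun s => (tnth s i).1).
    exact: measurableT_comp (@measurable_fst _ _ T C) (@measurable_tnth _ _ j i).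
  by apply/funext => s /=; rewrite tnth_mktuple.
have bpsi j (psi' : 'I_j -> C -> R) : (forall i, bmeas (psi' i)) ->
    bmeas (fun s : j.-tuple (T * C) => \prod_(i < j) psi' i (tnth s i).2).
  move=> bp; apply: bmeas_prod => i _; apply: bmeas_comp => //.
  exact: measurableT_comp (@measurable_snd _ _ T C) (@measurable_tnth _ _ j i).
elim: m Phi psi => [|m IH] Phi psi bPhi bp.
  by rewrite !mean_power0 !big_ord0 !mulr1; congr Phi; exact: tuple0.
rewrite mean_powerS; last first.
  by apply: bmeasM; [exact: bmeas_comp (mfst _) bPhi|exact: bpsi].
have bPhi1 x : bmeas (fun y => Phi (tcons (x, y))).
  apply: bmeas_comp => //; apply: (measurableT_comp (@measurable_tcons _ _ m)).
  exact: pair1_measurable.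
transitivity (\int[(mu \x k)%E]_z ((\int[power mu m]_y Phi (tcons (z.1, y)) *
    psi ord0 z.2) * \prod_(i < m) \int[k]_c psi (lift ord0 i) c)).
  apply: eq_Rintegral => z _; rewrite mulrAC -IH//.
  rewrite [RHS]mulrC -meanZ; last by apply: bmeasM; [exact: bmeas_comp (mfst _) (bPhi1 _)|exact: (bpsi _ (fun i => psi (lift ord0 i)))].
  apply: eq_Rintegral => s _; rewrite big_ord_recl tnth_tcons0/=.
  rewrite mulrCA; congr (_ * (_ * _)).
    congr Phi; apply: eq_from_tnth => i; rewrite tnth_mktuple.
    by have [j ->|->] := unliftP ord0 i; rewrite ?tnth_tconsS ?tnth_mktuple ?tnth_tcons0.
  by apply: eq_bigr => i _; rewrite tnth_tconsS.
have bm : bmeas (fun x => \int[power mu m]_y Phi (tcons (x, y))).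
  by apply: (bmeas_mean2 mu (power mu m) (f := Phi \o @tcons _ _ m)); exact: bmeas_comp.
have b1 : bmeas (fun z : T * C => \int[power mu m]_y Phi (tcons (z.1, y)) * psi ord0 z.2).
  by apply: bmeasM; [exact: (bmeas_comp (@measurable_fst _ _ T C) bm)|
    exact: (bmeas_comp (@measurable_snd _ _ T C) (bp ord0))].
under eq_Rintegral do rewrite mulrC.
rewrite meanZ// mean_prod//= mulrC big_ord_recl mulrA; congr (_ * _).
under eq_Rintegral do rewrite meanZ//.
under eq_Rintegral do rewrite mulrC.
by rewrite meanZ// mulrC -mean_powerS.
Qed.

Section coin_model.
Context {R : realType} d (T : measurableType d) (mu : probability T R).
Variables (D : T -> T -> bool) (p : R) (n : nat).
Hypothesis mD : measurable [set z : T * T | D z.1 z.2].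
Hypothesis p01 : 0 <= p <= 1.

Local Notation coins := (n.-tuple bool).
Local Notation kappa := (power (bernoulli_prob p) n).
Local Notation state := (T * coins)%type.
Local Notation nu := (mu \x kappa)%E.

Lemma mean_coins (J : {set 'I_n}) :
  \int[kappa]_c (\prod_(j in J) (tnth c j)%:R) = p ^+ #|J|.
Proof.
pose A j : set bool := if j \in J then [set true] else setT.
transitivity (fine (kappa [set c | [forall j, (j \in J) ==> tnth c j]])).
  rewrite -mean_bool; last first.
    apply: measurable_forall => j; case: (j \in J) => /=; last first.
      by rewrite (_ : [set _ | _] = setT)//; apply/seteqP.
    rewrite (_ : [set w | _] = (fun c => tnth c j) @^-1` [set true]).
      by rewrite -[X in measurable X]setTI; exact: measurable_tnth.
    by apply/seteqP; split => c /=.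
  apply: eq_Rintegral => c _; case: (boolP [forall _, _]) => [/forallP H|].
    by rewrite big1// => j jJ; have := H j; rewrite jJ /= => ->.
  rewrite negb_forall => /existsP[j]; rewrite negb_imply => /andP[jJ /negbTE cj].
  by rewrite (bigD1 j)//= cj mul0r.
rewrite (_ : [set c | _] = rectangle A); last first.
  apply/seteqP; split => [c /forallP H j|c H].
    by have := H j; rewrite /A; case: (j \in J) => //= ->.
  by apply/forallP => j; have := H j; rewrite /A; case: (j \in J) => //= ->.
transitivity (fine (\prod_(j < n) (if j \in J then p else 1)%:E)%E); last first.
  by rewrite prodEFin/= -big_mkcond/= prodr_const.
congr fine; transitivity (\prod_(j < n) (bernoulli_prob p (A j)))%E.
  by apply: power_rectangle.
apply: eq_bigr => j _; rewrite /A; case: (j \in J).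
  by rewrite /bernoulli_prob p01 fsbig_set1.
exact: (@probability_setT _ _ _ (bernoulli_prob p)).
Qed.

(* The edge i < j uses the j-th coin of i, so that del i (edges s) does not depend
   on the state of i. *)
Definition edges (s : n.-tuple state) : {set 'I_n * 'I_n} :=
  [set e : 'I_n * 'I_n | [&& (e.1 < e.2)%N, D (tnth s e.1).1 (tnth s e.2).1 &
               tnth (tnth s e.1).2 e.2]]%SET.

Lemma measurable_edges e : measurable [set s | e \in edges s].
Proof.
have [e12|e12] := boolP (e.1 < e.2)%N; last first.
  rewrite (_ : [set s | _] = set0)//; apply/seteqP; split => // s /=.
  by rewrite inE (negbTE e12).
rewrite (_ : [set s | _] =
   (fun s => ((tnth s e.1).1, (tnth s e.2).1)) @^-1` [set z | D z.1 z.2] `&`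
   (fun s => tnth (tnth s e.1).2 e.2) @^-1` [set true]); last first.
  apply/seteqP; split => s /=; first by rewrite inE e12/= => /andP[].
  by move=> [Ds cs]; rewrite inE e12 Ds.
have mt i : measurable_fun setT (fun s : n.-tuple state => (tnth s i).1).
  exact: measurableT_comp (@measurable_fst _ _ T coins) (@measurable_tnth _ _ n i).
apply: measurableI.
  rewrite -[X in measurable X]setTI.
  by apply: (measurable_fun_pair (mt _) (mt _)).
rewrite -[X in measurable X]setTI.
have := measurableT_comp (@measurable_tnth _ bool n e.2)
  (measurableT_comp (@measurable_snd _ _ T coins) (@measurable_tnth _ _ n e.1)).
by apply.
Qed.

Definition edge_law : {set 'I_n * 'I_n} -> R := law (power nu n) edges.

Lemma mean_subset_edges (A : {set 'I_n * 'I_n}) : (forall e, e \in A -> (e.1 < e.2)%N) ->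
  \int[power nu n]_s (A \subset edges s)%:R =
  \int[power mu n]_x \prod_(e in A) (p * (D (tnth x e.1) (tnth x e.2))%:R).
Proof.
move=> A12.
have bD (e : 'I_n * 'I_n) :
    bmeas (fun x : n.-tuple T => (D (tnth x e.1) (tnth x e.2))%:R : R).
  apply: (bmeas_comp (h := fun x => (tnth x e.1, tnth x e.2)) (f := fun z => (D z.1 z.2)%:R)).
    by apply: measurable_fun_pair; exact: measurable_tnth.
  exact: bmeas_bool.
have bPhi : bmeas (fun x : n.-tuple T => \prod_(e in A) (D (tnth x e.1) (tnth x e.2))%:R : R).
  by apply: bmeas_prod.
(* [J i] collects the coins of [i] that [A] inspects. Distinct edges inspect distinct coins, so each
   edge yields one factor [p]. *)
pose J i := [set j | (i, j) \in A]%SET.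
have bc (j : 'I_n) : bmeas (fun c : coins => (tnth c j)%:R : R).
  apply: bmeas_bool; rewrite (_ : [set x | _] = (fun c => tnth c j) @^-1` [set true]).
    by rewrite -[X in measurable X]setTI; exact: measurable_tnth.
  by apply/seteqP; split => c /=.
have prodJ (F : 'I_n -> 'I_n -> R) :
    \prod_(e in A) F e.1 e.2 = \prod_(i < n) \prod_(j in J i) F i j.
  rewrite pair_big_dep; apply: eq_bigl => -[i j] /=; by rewrite inE.
transitivity (\int[power nu n]_s
   ((fun x => \prod_(e in A) (D (tnth x e.1) (tnth x e.2))%:R) [tuple (tnth s i).1 | i < n] *
    \prod_(i < n) (fun c : coins => \prod_(j in J i) (tnth c j)%:R) (tnth s i).2)).
  apply: eq_Rintegral => s _ /=.
  rewrite -(prodJ (fun i j => (tnth (tnth s i).2 j)%:R)) -big_split/=.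
  case: (boolP (A \subset _)) => [/fintype.subsetP As|/fintype.subsetPn[e eA es]].
    by rewrite big1// => e eA; have := As e eA; rewrite inE !tnth_mktuple =>
      /and3P[_ -> ->]; rewrite mulr1.
  rewrite (bigD1 e)//=; move: es; rewrite inE A12//= negb_and !tnth_mktuple.
  by move=> /orP[]/negbTE ->; rewrite ?(mul0r, mulr0).
transitivity (\int[power mu n]_x (\prod_(e in A) (D (tnth x e.1) (tnth x e.2))%:R) *
    \prod_(i < n) \int[kappa]_c \prod_(j in J i) (tnth c j)%:R).
  apply: (mean_power_pair mu kappa
    (psi := fun i (c : coins) => \prod_(j in J i) (tnth c j)%:R) bPhi).
  by move=> i; apply: bmeas_prod.
rewrite mulrC -meanZ//; apply: eq_Rintegral => x _.
rewrite big_split/=; congr (_ * _).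
under eq_bigr do rewrite mean_coins -prodr_const.
by rewrite -(prodJ (fun _ _ => p)).
Qed.

Lemma sum_edge_law (f : {set 'I_n * 'I_n} -> R) :
  \int[power nu n]_s f (edges s) = \sum_E edge_law E * f E.
Proof.
by apply: mean_finval => E; apply: measurable_eqset => e; exact: measurable_edges.
Qed.

(** In Efron-Stein, [g i] is [f] after deletion of [i]: every edge that depends on the position or
    the coins of [i] has [i] as an endpoint. *)
Lemma edge_law_variance (f : {set 'I_n * 'I_n} -> R) :
  \sum_E edge_law E * f E ^+ 2 - (\sum_E edge_law E * f E) ^+ 2 <=
  \sum_(i < n) \sum_E edge_law E * (f E - f (del i E)) ^+ 2.
Proof.
have mE E : measurable [set s | edges s == E].
  by apply: measurable_eqset => e; exact: measurable_edges.
rewrite -!sum_edge_law.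
under eq_bigr => i _ do rewrite -(sum_edge_law (fun E => (f E - f (del i E)) ^+ 2)).
apply: (efron_stein nu (f := f \o edges) (g := fun i s => f (del i (edges s)))).
- by apply: (bmeas_finval (power nu n)).
- by move=> i; apply: (bmeas_finval (power nu n) _ (f \o del i)).
move=> i x y xy; congr f; apply/setP => e; rewrite !inE.
case: (eqVneq e.1 i) => [|e1]; first by rewrite !andbF.
case: (eqVneq e.2 i) => [|e2]; first by rewrite !andbF.
by rewrite !xy.
Qed.

End coin_model.

(** * Inclusion probabilities *)

Section inclusion.
Context {R : realType} d (T : measurableType d) (mu : probability T R).
Variables (D : T -> T -> bool) (p : R) (n : nat).
Hypothesis mD : measurable [set z : T * T | D z.1 z.2].
Hypothesis Dsym : forall x y, D x y = D y x.

Definition incl (A : {set 'I_n * 'I_n}) : R :=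
  \int[power mu n]_x \prod_(e in A) (p * (D (tnth x e.1) (tnth x e.2))%:R).

Lemma bmeas_D : bmeas (fun z : T * T => (D z.1 z.2)%:R : R).
Proof. exact: bmeas_bool. Qed.

Lemma bmeas_tnth2 (i j : 'I_n) :
  bmeas (fun x : n.-tuple T => (D (tnth x i) (tnth x j))%:R : R).
Proof.
apply: (bmeas_comp (h := fun x => (tnth x i, tnth x j)) _ bmeas_D).
by apply: measurable_fun_pair; exact: measurable_tnth.
Qed.

Lemma bmeas_incl (A : {set 'I_n * 'I_n}) : bmeas (fun x : n.-tuple T =>
  \prod_(e in A) (p * (D (tnth x e.1) (tnth x e.2))%:R) : R).
Proof. by apply: bmeas_prod => e _; apply/bmeasZ/bmeas_tnth2. Qed.

Lemma D_opair (x : n.-tuple T) u v :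
  D (tnth x (opair u v).1) (tnth x (opair u v).2) = D (tnth x u) (tnth x v).
Proof. by rewrite /opair; case: ifP. Qed.

(* The vertex w is a leaf: its position occurs in a single factor. *)
Lemma incl_leaf (A : {set 'I_n * 'I_n}) u w q0 :
  (forall x, \int[mu]_y (D x y)%:R = q0) ->
  u != w -> (forall e, e \in A -> e.1 != w /\ e.2 != w) ->
  incl (opair u w |: A) = p * q0 * incl A.
Proof.
move=> Dq uw Aw; rewrite /incl (mean_power_upd _ w); last exact: bmeas_incl.
rewrite -meanZ; last exact: bmeas_incl.
apply: eq_Rintegral => x _.
have nA : opair u w \notin A.
  by apply/negP => /Aw; rewrite /opair; case: ifP => _ /=; rewrite eqxx => -[].
under eq_Rintegral do rewrite big_setU1//= D_opair !tnth_upd eqxx (negbTE uw).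
transitivity (\int[mu]_y ((p * \prod_(e in A) (p * (D (tnth x e.1) (tnth x e.2))%:R)) *
    (D (tnth x u) y)%:R)).
  apply: eq_Rintegral => y _; rewrite mulrAC; congr (_ * _ * _).
  by apply: eq_bigr => e /Aw[e1 e2]; rewrite !tnth_upd (negbTE e1) (negbTE e2).
rewrite meanZ ?Dq 1?mulrAC//.
exact: (bmeas_comp (pair1_measurable (tnth x u)) bmeas_D).
Qed.

(** The positions of [v] and [w] are resampled with [u] frozen; by hypothesis the inner integral is
    the same wherever [u] lies. *)
Lemma incl_triangle u v w t0 :
  (forall x, \int[mu]_y \int[mu]_z ((D x y)%:R * (D y z)%:R * (D x z)%:R) = t0) ->
  u != v -> v != w -> u != w ->
  incl [set opair u v; opair v w; opair u w] = p ^+ 3 * t0.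
Proof.
move=> Dt uv vw uw; rewrite /incl.
have bp3 : bmeas (fun x : n.-tuple T => p ^+ 3 * ((D (tnth x u) (tnth x v))%:R *
    (D (tnth x v) (tnth x w))%:R * (D (tnth x u) (tnth x w))%:R) : R).
  by apply/bmeasZ/bmeasM; [apply: bmeasM|]; exact: bmeas_tnth2.
have op (a b c e : 'I_n) : opair a b = opair c e -> (a = c /\ b = e) \/ (a = e /\ b = c).
  by rewrite /opair; case: ifP => _; case: ifP => _ [-> ->]; auto.
transitivity (\int[power mu n]_x (p ^+ 3 * ((D (tnth x u) (tnth x v))%:R *
    (D (tnth x v) (tnth x w))%:R * (D (tnth x u) (tnth x w))%:R))).
  apply: eq_Rintegral => x _; rewrite finset.setUC big_setU1/=; last first.
    rewrite !inE negb_or; apply/andP; split; apply/eqP => /op.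
      by move=> [[_ wv]|[uv' _]]; [rewrite wv eqxx in vw|rewrite uv' eqxx in uv].
    by move=> [[uv' _]|[uw' _]]; [rewrite uv' eqxx in uv|rewrite uw' eqxx in uw].
  rewrite big_setU1/=; last first.
    rewrite !inE; apply/eqP => /op.
    by move=> [[uv' _]|[uw' _]]; [rewrite uv' eqxx in uv|rewrite uw' eqxx in uw].
  by rewrite big_set1 !D_opair; ring.
rewrite (mean_power_upd _ v)//.
pose g (x : n.-tuple T) (y z : T) : R := (D (tnth x u) y)%:R * (D y z)%:R * (D (tnth x u) z)%:R.
have bg x y : bmeas (g x y).
  apply: bmeasM; last exact: (bmeas_comp (pair1_measurable (tnth x u)) bmeas_D).
  by apply: bmeasZ; exact: (bmeas_comp (pair1_measurable y) bmeas_D).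
rewrite (mean_power_upd _ w); last first.
  apply: (bmeas_mean2 (power mu n) mu (f := (fun x : n.-tuple T => p ^+ 3 * ((D (tnth x u) (tnth x v))%:R *
    (D (tnth x v) (tnth x w))%:R * (D (tnth x u) (tnth x w))%:R)) \o upd v)).
  by apply: bmeas_comp => //; exact: measurable_upd.
rewrite -[RHS](mean_cst (power mu n)); apply: eq_Rintegral => x _.
transitivity (\int[mu]_z \int[mu]_y (p ^+ 3 * g x y z)).
  apply: eq_Rintegral => z _; apply: eq_Rintegral => y _.
  rewrite !tnth_upd !eqxx (negbTE uv) (negbTE uw) (eq_sym w) (negbTE vw).
  by rewrite /g/=.
have bx (h : T * T -> T) : measurable_fun setT h ->
    bmeas (fun yz : T * T => (D (tnth x u) (h yz))%:R : R).
  move=> mh; apply: (bmeas_comp (h := fun yz : T * T => (tnth x u, h yz)) _ bmeas_D).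
  exact: measurable_fun_pair.
have bxy := bx _ (@measurable_fst _ _ T T).
have bxz := bx _ (@measurable_snd _ _ T T).
have bG : bmeas (fun yz : T * T => p ^+ 3 * g x yz.1 yz.2).
  apply: bmeasZ; apply: bmeasM; last exact: bxz.
  by apply: bmeasM; [exact: bxy|exact: bmeas_D].
(* Resampling [v] before [w] has left the integral over [w] outside, the reverse of the order in the
   hypothesis. *)
rewrite -(mean_swap mu mu bG)/= -(Dt (tnth x u)) -meanZ; last first.
  apply: (bmeas_mean2 mu mu (f := fun yz => g x yz.1 yz.2)).
  apply: bmeasM; last exact: bxz.
  by apply: bmeasM; [exact: bxy|exact: bmeas_D].
by apply: eq_Rintegral => y _; rewrite -meanZ//; exact: bg.
Qed.

Lemma sum_upset_edge_law (A : {set 'I_n * 'I_n}) : 0 <= p <= 1 ->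
  (forall e, e \in A -> (e.1 < e.2)%N) ->
  \sum_(E : {set 'I_n * 'I_n} | A \subset E) edge_law mu D p E = incl A.
Proof.
move=> p01 A12; rewrite -[RHS](mean_subset_edges mu mD p01 A12).
rewrite (sum_edge_law mu p mD (fun E => (A \subset E)%:R)) big_mkcond/=.
by apply: eq_bigr => E _; case: (A \subset E); rewrite ?mulr1 ?mulr0.
Qed.

End inclusion.

(** * The edge set of the random geometric graph has the law of the coin model *)

Section rgg_law.
Context {R : realType} {dO : measure_display} {Omega : measurableType dO}.
Variables (P : probability Omega R) (n : nat).

Section joint_law.
Context dT (T : measurableType dT) (X : 'I_n -> {RV P >-> T}).

Definition joint (w : Omega) : n.-tuple T := [tuple X i w | i < n].

Lemma measurable_joint : measurable_fun setT joint.
Proof.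
apply/measurable_fun_tnthP => i; rewrite (_ : _ \o _ = X i) //.
by apply/funext => w; rewrite /= tnth_mktuple.
Qed.

HB.instance Definition _ := isMeasurableFun.Build _ _ _ _ joint measurable_joint.

Lemma joint_law (mu : probability T R) :
  (forall i A, measurable A -> P (X i @^-1` A) = mu A) ->
  mutually_independent X ->
  forall B, measurable B -> distribution P joint B = power mu n B.
Proof.
move=> Xmu indX; apply: finite_tuple_measure_unique; first exact: probability_lty.
move=> A mA; transitivity (\prod_(i < n) mu (A i))%E; last exact/esym/power_rectangle.
transitivity (P [set w | forall i, i \in [set: 'I_n]%SET -> A i (X i w)]).
  congr (P _); apply/seteqP; split => w /= H i.
    by move=> _; have := H i; rewrite tnth_mktuple.
  by rewrite tnth_mktuple; exact: H (finset.in_setT _).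
rewrite indX//; under eq_bigl do rewrite inE.
by apply: eq_bigr => i _; exact: Xmu.
Qed.

End joint_law.

Variables (d : nat) (p r : R) (X : 'I_n -> {RV P >-> (d.-tuple R)}).
Variables (G : Omega -> simple_graph 'I_n) (mu : probability (d.-tuple R) R).

Local Notation near := (fun x y : d.-tuple R => torus_dist n x y <= r).

Definition edge_set (H : simple_graph 'I_n) : {set 'I_n * 'I_n} :=
  [set e : 'I_n * 'I_n | (e.1 < e.2)%N && adj H e.1 e.2]%SET.

Hypothesis p01 : 0 <= p <= 1.
Hypothesis mnear : measurable [set z : d.-tuple R * d.-tuple R | near z.1 z.2].
Hypothesis GX : is_RGG p r X G.
Hypothesis Xmu : forall i A, measurable A -> P (X i @^-1` A) = mu A.

Lemma measurable_edge_set e : measurable [set w | e \in edge_set (G w)].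
Proof.
have [e12|e12] := boolP (e.1 < e.2)%N.
  rewrite (_ : [set w | _] = [set w | adj (G w) e.1 e.2]).
    exact: rgg_measurable GX _ _.
  by apply/seteqP; split => w /=; rewrite inE e12.
rewrite (_ : [set w | _] = set0)//; apply/seteqP; split => // w /=.
by rewrite inE (negbTE e12).
Qed.

(** By [upset_sum_inj] only inclusion probabilities matter. For the given graph they come from
    [rgg_edges] with the trivial event on positions, for the coin model from [sum_upset_edge_law];
    both equal [incl]. *)
Lemma rgg_edge_law (B : pred {set 'I_n * 'I_n}) :
  P [set w | B (edge_set (G w))] = (\sum_(E | B E) edge_law mu near p E)%:E.
Proof.
have mG E : measurable [set w | edge_set (G w) == E].
  exact/measurable_eqset/measurable_edge_set.
have mE (E : {set 'I_n * 'I_n}) : measurable [set s | edges near s == E].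
  by apply: measurable_eqset => e; exact: measurable_edges.
suff lawE : law P (edge_set \o G) =1 @edge_law _ _ _ mu near p n.
  by rewrite (law_event P mG); congr EFin; apply: eq_bigr => E _; exact: lawE.
apply: upset_sum_inj => A.
have [A12|] := boolP [forall e in A, (e.1 < e.2)%N]; last first.
  (* A pattern containing a non-increasing pair has probability 0 under both laws. *)
  rewrite negb_forall => /existsP[e]; rewrite negb_imply => /andP[eA e12].
  transitivity (0 : R).
    apply: EFin_inj; rewrite -(law_event P mG (fun E => A \subset E)).
    rewrite (_ : [set w | _] = set0) ?measure0//; apply/seteqP; split => // w /=.
    by move=> /fintype.subsetP/(_ _ eA); rewrite inE (negbTE e12).
  apply/esym/EFin_inj; rewrite -(law_event (power _ _) mE (fun E => A \subset E)).
  rewrite (_ : [set s | _] = set0) ?measure0//; apply/seteqP; split => // w /=.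
  by move=> /fintype.subsetP/(_ _ eA); rewrite inE (negbTE e12).
have {}A12 e : e \in A -> (e.1 < e.2)%N by move/forallP : A12 => /(_ e)/implyP.
rewrite sum_upset_edge_law//; apply: EFin_inj.
rewrite -(law_event P mG (fun E => A \subset E)).
have := rgg_edges GX (@measurableT _ (n.-tuple (d.-tuple R))) A12.
rewrite setTI (_ : [set w | forall e, _] = [set w | A \subset edge_set (G w)]).
  move=> ->; rewrite (_ : [set w | _] = setT); last by apply/seteqP.
  pose F x : R := \prod_(e in A) (p * (near (tnth x e.1) (tnth x e.2))%:R).
  have bF : bmeas F by exact: bmeas_incl.
  rewrite [in LHS](_ : (fun _ => _) = EFin \o (F \o joint X)); last first.
    by apply/funext => w; congr EFin; apply: eq_bigr => e _; rewrite !tnth_mktuple.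
  rewrite -[LHS]fineK; last first.
    apply: integrable_fin_num => //; apply: bmeas_integrable.
    exact: bmeas_comp (measurable_joint X) bF.
  congr EFin; transitivity (\int[distribution P (joint X)]_x F x).
    by rewrite mean_distribution.
  exact/mean_ext/(joint_law Xmu (rgg_indep GX)).
apply/seteqP; split => w /= H.
  by apply/fintype.subsetP => e eA; rewrite inE A12//= H.
by move=> e eA; move/fintype.subsetP : H => /(_ _ eA); rewrite inE => /andP[].
Qed.

End rgg_law.

(** * Poisson limits *)

Section annd_formula.
Context {R : realType} {n : nat}.
Variable G : simple_graph 'I_n.

Definition annd_edges k (E : {set 'I_n * 'I_n}) : R :=
  (\sum_u (deg E u == k)%:R * (nbdeg E u)%:R) / (k%:R * count_deg k E).

Local Notation E := (edge_set G).

Lemma adj_nb u v : adj G u v = (v \in nb E u).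
Proof.
rewrite !inE /opair; case: (ltngtP u v) => [uv|uv|/val_inj ->].
- by rewrite uv/= -(inj_eq val_inj) gtn_eqF.
- by rewrite uv/= -(inj_eq val_inj) ltn_eqF//= adj_sym.
- by rewrite eqxx adj_irrefl.
Qed.

Lemma degree_deg u : degree G u = deg E u.
Proof. by rewrite /degree /deg; apply: eq_card => v; rewrite -adj_nb. Qed.

Lemma sum_dir_edges (F : 'I_n -> 'I_n -> R) :
  \sum_(e in dir_edges G) F e.1 e.2 = \sum_u \sum_(v in nb E u) F u v.
Proof.
by rewrite pair_big_dep; apply: eq_bigl => e; rewrite inE -adj_nb.
Qed.

Lemma size_biased_sum k :
  \sum_(e in dir_edges G) (degree G e.1 == k)%:R = k%:R * count_deg k E :> R.
Proof.
rewrite (sum_dir_edges (fun u _ => (degree G u == k)%:R)) mulr_sumr.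
apply: eq_bigr => u _; rewrite sumr_const -/(deg E u) degree_deg.
by case: eqP => [->|_]; rewrite ?mulr1// mulr0 mul0rn.
Qed.

(** Degrees are below [n], so the partial sums are constant from [n] on; starting at [l = 1] only
    omits a zero term. *)
Lemma joint_series k :
  \big[+%R/0]_(1 <= l <oo) (l%:R * joint_deg_freq G k l) =
  #|dir_edges G|%:R^-1 * (\sum_u (deg E u == k)%:R * (nbdeg E u)%:R) :> R.
Proof.
apply: lim_near_cst => //; near=> N.
have nN : (n <= N)%N by near: N; exact: nbhs_infty_ge.
under eq_bigr do rewrite mulrCA.
rewrite -mulr_sumr; congr (_ * _).
under eq_bigr do rewrite mulr_sumr.
rewrite exchange_big/= -[RHS](_ : \sum_(e in dir_edges G)
    (degree G e.1 == k)%:R * (degree G e.2)%:R = _).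
  apply: eq_bigr => e _; rewrite degree_deg (degree_deg e.2).
  case: (deg E e.1 == k) => /=; last by rewrite mul0r big1// => l _; rewrite mulr0.
  rewrite mul1r; have [d0|d0] := posnP (deg E e.2).
    by rewrite d0 big_nat big1// => -[|l]//= _; rewrite mulr0.
  rewrite (bigD1_seq (deg E e.2)) ?iota_uniq//=; last first.
    by rewrite mem_index_iota d0 (leq_trans (deg_lt _ _)).
  by rewrite eqxx mulr1 big1 ?addr0// => l /negbTE; rewrite eq_sym => ->; rewrite mulr0.
rewrite (sum_dir_edges (fun u v => (degree G u == k)%:R * (degree G v)%:R)).
apply: eq_bigr => u _; rewrite /nbdeg natr_sum mulr_sumr degree_deg.
by apply: eq_bigr => v _; rewrite degree_deg.
Unshelve. all: by end_near. Qed.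

(** The number of directed edges cancels, being nonzero once some vertex has degree [k > 0]. If
    there is no such vertex, division by zero gives 0, in line with the convention in [annd]. *)
Lemma annd_edgesE k : (0 < k)%N -> annd G k = annd_edges k E.
Proof.
move=> k0; rewrite /annd /annd_edges joint_series /size_biased_deg_freq size_biased_sum.
have cE : deg_freq G k = n%:R^-1 * count_deg k E :> R.
  by rewrite /deg_freq card_ord; congr (_ * _); apply: eq_bigr => u _; rewrite degree_deg.
have c0 : 0 <= count_deg k E :> R by apply: sumr_ge0.
move: c0; rewrite le_eqVlt => /predU1P[c0|c0].
  by rewrite cE -c0 !mulr0 ltxx mul0r invr0 mulr0.
have n0 : 0 < n%:R :> R.
  rewrite ltr0n lt0n; apply: contraTneq c0 => n0.
  by rewrite -leNgt /count_deg big1// => -[u un]; exfalso; rewrite n0 in un.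
have e0 : #|dir_edges G|%:R != 0 :> R.
  apply: contraTneq c0 => e0; have : k%:R * count_deg k E = 0 :> R.
    rewrite -size_biased_sum big1// => e eE; move/eqP: e0.
    by rewrite pnatr_eq0 cards_eq0 => /eqP e0; rewrite e0 inE in eE.
  move/eqP; rewrite mulf_eq0 pnatr_eq0 gtn_eqF//= => /eqP ->; by rewrite ltxx.
rewrite cE mulr_gt0 ?invr_gt0// mul1r; field.
by rewrite e0 (gt_eqF c0) pnatr_eq0 -lt0n k0.
Qed.

End annd_formula.

Lemma cvg_near_eq {R : realType} (v u : nat -> R) (l' l : R) : v @ \oo --> l' -> l' = l ->
  (\forall n \near \oo, u n = v n) -> u @ \oo --> l.
Proof.
move=> vl <- uv; apply: cvg_trans vl; apply: near_eq_cvg.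
by apply: filterS uv => n ->.
Qed.

(** * From binomial to Poisson *)

Section poisson_limit.
Context {R : realType}.
Variable lambda : R.
Hypothesis l0 : 0 < lambda.

Lemma cvg_natinv : n%:R^-1 @[n --> \oo] --> (0 : R).
Proof. by rewrite -cvg_shiftS; exact: cvg_harmonic. Qed.

Lemma cvg_subn_div c : (n - c)%:R / n%:R @[n --> \oo] --> (1 : R).
Proof.
apply: (@cvg_near_eq _ (fun n => 1 - c%:R * n%:R^-1) _ (1 - c%:R * 0)).
- by apply: cvgB; [exact: cvg_cst|apply: cvgM; [exact: cvg_cst|exact: cvg_natinv]].
- by rewrite mulr0 subr0.
near=> n.
have nc : (c < n)%N by near: n; exact: nbhs_infty_gt.
have n0 : n%:R != 0 :> R by rewrite pnatr_eq0 -lt0n (leq_ltn_trans _ nc).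
by rewrite /= natrB ?(ltnW nc)//; field.
Unshelve. all: by end_near. Qed.

Lemma cvg_bin c j : 'C(n - c, j)%:R / n%:R ^+ j @[n --> \oo] --> (j`!%:R^-1 : R).
Proof.
elim: j => [|j IH].
  by under eq_cvg do rewrite bin0 expr0 divr1; rewrite fact0 invr1; exact: cvg_cst.
apply: (@cvg_near_eq _ (fun n => 'C(n - c, j)%:R / n%:R ^+ j *
    ((n - (c + j))%:R / n%:R) * j.+1%:R^-1) _ (j`!%:R^-1 * 1 * j.+1%:R^-1)).
- by apply: cvgM; [apply: cvgM; [exact: IH|exact: (cvg_subn_div (c + j))]|exact: cvg_cst].
- by rewrite mulr1 factS natrM invfM mulrC.
near=> n.
have n0 : n%:R != 0 :> R by rewrite pnatr_eq0 -lt0n; near: n; exact: nbhs_infty_gt.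
have := mul_bin_left (n - c) j => /(congr1 (fun m => m%:R : R)).
rewrite !natrM subnDA => h.
have j0 : j.+1%:R != 0 :> R by rewrite pnatr_eq0.
have -> : 'C(n - c, j.+1)%:R = (n - c - j)%:R * 'C(n - c, j)%:R / j.+1%:R :> R.
  by rewrite -h mulrAC divff// mul1r.
by rewrite exprS; field; rewrite ?n0 ?nat1r ?j0 ?expf_neq0.
Unshelve. all: by end_near. Qed.

Lemma cvg_1B_div : 1 - lambda / n%:R @[n --> \oo] --> (1 : R).
Proof.
apply: (@cvg_near_eq _ (fun n => 1 - lambda * n%:R^-1) _ (1 - lambda * 0)).
- by apply: cvgB; [exact: cvg_cst|apply: cvgM; [exact: cvg_cst|exact: cvg_natinv]].
- by rewrite mulr0 subr0.
- by apply: nearW.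
Qed.

(** Squeeze between exp(-lambda / (1 - lambda/n)) and exp(-lambda): both bounds are 1 + x <= exp(x),
    taken at x = (lambda/n) / (1 - lambda/n) and at x = -lambda/n. *)
Lemma cvg_exp_n : (1 - lambda / n%:R) ^+ n @[n --> \oo] --> expR (- lambda).
Proof.
have d := cvg_1B_div.
apply: (@squeeze_cvgr _ _ _ _ (fun n => expR (- lambda / (1 - lambda / n%:R)))
    (fun=> expR (- lambda))); last 2 first.
- apply: (@cvg_comp _ _ _ (fun n => - lambda / (1 - lambda / n%:R)) expR _ (nbhs (- lambda))).
    have -> : - lambda = - lambda * 1^-1 :> R by rewrite invr1 mulr1.
    apply: cvgM; first by rewrite invr1 mulr1; exact: cvg_cst.
    by apply: cvgV => //; exact: oner_neq0.
  exact: continuous_expR.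
- exact: cvg_cst.
near=> n.
have n0 : 0 < n%:R :> R by rewrite ltr0n; near: n; exact: nbhs_infty_gt.
have n1 : (0 < n)%N by rewrite -(ltr0n R).
have q0 : 0 < 1 - lambda / n%:R by near: n; apply: (cvgr_gt _ d); exact: ltr01.
apply/andP; split.
  rewrite (_ : - lambda / _ = n%:R * (- (lambda / n%:R / (1 - lambda / n%:R)))); last first.
    have : 0 < n%:R - lambda.
      by have := mulr_gt0 q0 n0; rewrite mulrBl mul1r divfK ?gt_eqF.
    by move=> nl; field; rewrite ?gt_eqF.
  rewrite expRM_natl ler_pXn2r ?nnegrE ?expR_ge0 ?(ltW q0)//.
  rewrite expRN -[leRHS]invrK lef_pV2 ?posrE ?invr_gt0 ?expR_gt0//.
  rewrite [leLHS](_ : _ = 1 + lambda / n%:R / (1 - lambda / n%:R)) ?expR_ge1Dx//.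
  by apply: (mulIf (lt0r_neq0 q0)); rewrite mulVf ?gt_eqF// mulrDl mul1r divfK ?gt_eqF// subrK.
rewrite (_ : - lambda = n%:R * (- (lambda / n%:R))); last by field; rewrite gt_eqF.
rewrite expRM_natl ler_pXn2r ?nnegrE ?expR_ge0 ?(ltW q0)//.
by rewrite expR_ge1Dx.
Unshelve. all: by end_near. Qed.

Lemma cvg_exp_sub c : (1 - lambda / n%:R) ^+ (n - c) @[n --> \oo] --> expR (- lambda).
Proof.
have d := cvg_1B_div.
have dc : ((1 - lambda / n%:R) ^+ c)^-1 @[n --> \oo] --> (1 : R).
  rewrite -[X in _ --> X]invr1; apply: cvgV; first exact: oner_neq0.
  elim: (c) => [|m IH]; first by under eq_cvg do rewrite expr0; exact: cvg_cst.
  apply: (@cvg_near_eq _ (fun n => (1 - lambda / n%:R) * (1 - lambda / n%:R) ^+ m) _ (1 * 1)).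
  - exact: cvgM.
  - by rewrite mulr1.
  - by apply: nearW => n; rewrite exprS.
apply: (@cvg_near_eq _ (fun n => (1 - lambda / n%:R) ^+ n * ((1 - lambda / n%:R) ^+ c)^-1) _
    (expR (- lambda) * 1)); [|by rewrite mulr1|].
  by apply: cvgM; [exact: cvg_exp_n|exact: dc].
near=> n.
have nc : (c <= n)%N by near: n; exact: nbhs_infty_ge.
have q0 : 0 < 1 - lambda / n%:R by near: n; apply: (cvgr_gt _ d); exact: ltr01.
have qc : (1 - lambda / n%:R) ^+ c != 0 by rewrite expf_neq0// gt_eqF.
by apply: (mulIf qc); rewrite divfK// -exprD subnK.
Unshelve. all: by end_near. Qed.

Definition poisson j : R := lambda ^+ j * expR (- lambda) / j`!%:R.

Lemma cvg_binpmf c j :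
  binpmf (lambda / n%:R) (n - c) j @[n --> \oo] --> poisson j.
Proof.
apply: (@cvg_near_eq _ (fun n => 'C(n - c, j)%:R / n%:R ^+ j * lambda ^+ j *
    (1 - lambda / n%:R) ^+ (n - (c + j))) _ (j`!%:R^-1 * lambda ^+ j * expR (- lambda))).
- apply: cvgM; last exact: (cvg_exp_sub (c + j)).
  by apply: cvgM; [exact: (@cvg_bin c j)|exact: cvg_cst].
- by rewrite /poisson [RHS]mulrC mulrA.
apply: nearW => n.
rewrite /binpmf subnDA exprMn exprVn; congr (_ * _).
by rewrite -!mulrA; congr (_ * _); exact: mulrC.
Qed.

Lemma poissonS j : j.+1%:R * poisson j.+1 = lambda * poisson j.
Proof.
rewrite /poisson factS natrM exprS; field.
by rewrite nat1r !pnatr_eq0 -lt0n fact_gt0.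
Qed.

Lemma poisson_gt0 j : 0 < poisson j.
Proof. by rewrite divr_gt0 ?mulr_gt0 ?exprn_gt0 ?expR_gt0// ltr0n fact_gt0. Qed.

Variable rho : R.

(** Here [rho] is t / q^2, the probability that a path closes to a triangle. A neighbour [v] of a
    vertex [u] of degree [k.+1] has the edge back to [u], on average k rho edges to the other
    neighbours of [u], and lambda (1 - rho) edges elsewhere. *)
Definition annd_limit k : R := 1 + lambda * (1 - rho) + k%:R * rho.

(* annd_limit k is the value of K / k.+1 for which the limiting mean vanishes. *)
Lemma cvg_full_sum_mean k (K := k.+1%:R * annd_limit k) :
  (k.+1%:R - K) * binpmf (lambda / n%:R) n.-1 k.+1 + (n.-1 * n.-2)%:R *
    (lambda ^+ 2 * rho / n%:R ^+ 2 * tri_pmf (lambda / n%:R) (n - 3) k +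
     ((lambda / n%:R) ^+ 2 - lambda ^+ 2 * rho / n%:R ^+ 2) *
       binpmf (lambda / n%:R) (n - 3) k) @[n --> \oo] --> (0 : R).
Proof.
pose tpoisson := if k is k'.+1 then poisson k' else 0.
have t3 : tri_pmf (lambda / n%:R) (n - 3) k @[n --> \oo] --> (tpoisson : R).
  by rewrite /tpoisson /tri_pmf; case: (k) => [|k']; [exact: cvg_cst|exact: cvg_binpmf].
apply: (@cvg_near_eq _ (fun n => (k.+1%:R - K) * binpmf (lambda / n%:R) (n - 1) k.+1 +
    (n - 1)%:R / n%:R * ((n - 2)%:R / n%:R) *
    (lambda ^+ 2 * rho * tri_pmf (lambda / n%:R) (n - 3) k +
     lambda ^+ 2 * (1 - rho) * binpmf (lambda / n%:R) (n - 3) k)) _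
   ((k.+1%:R - K) * poisson k.+1 + (1 * 1) *
    (lambda ^+ 2 * rho * tpoisson + lambda ^+ 2 * (1 - rho) * poisson k))).
- apply: cvgD; first by apply: cvgM; [exact: cvg_cst|exact: (@cvg_binpmf 1 k.+1)].
  apply: cvgM.
    by apply: cvgM; [exact: (cvg_subn_div 1)|exact: (cvg_subn_div 2)].
  apply: cvgD; apply: cvgM.
  + exact: cvg_cst.
  + exact: t3.
  + exact: cvg_cst.
  + exact: (@cvg_binpmf 3 k).
(* The Poisson recursion turns every term into a multiple of [lambda * poisson k]; the coefficients
   add up to 1 - c + k rho + lambda (1 - rho) = 0 with c the value of [annd_limit]. *)
- have -> : (k.+1%:R - K) * poisson k.+1 = (1 - annd_limit k) * (lambda * poisson k).
    by rewrite -poissonS /K; ring.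
  have -> : lambda ^+ 2 * rho * tpoisson = lambda * rho * (k%:R * poisson k).
    rewrite /tpoisson; case: (k) => [|k']; first by rewrite !mul0r !mulr0.
    by rewrite poissonS; ring.
  by rewrite /annd_limit; ring.
near=> n.
have n0 : n%:R != 0 :> R by rewrite pnatr_eq0 -lt0n; near: n; exact: nbhs_infty_gt.
rewrite subn1 subn2; congr (_ + _); rewrite natrM; by field.
Unshelve. all: by end_near. Qed.

Lemma exp_mean_degree_le n : (1 + lambda / n%:R) ^+ n.-1 <= expR lambda.
Proof.
have [->|n0] := posnP n; first by rewrite expr0 ltW// expR_gt1.
have l1 : 1 <= 1 + lambda / n%:R by rewrite lerDl divr_ge0// ltW.
apply: (@le_trans _ _ ((1 + lambda / n%:R) ^+ n)).
  by rewrite ler_weXn2l// leq_pred.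
rewrite -[X in expR X](_ : n%:R * (lambda / n%:R) = _); last first.
  by field; rewrite pnatr_eq0 -lt0n.
by rewrite expRM_natl ler_pXn2r ?nnegrE ?expR_ge0 ?expR_ge1Dx// (le_trans ler01).
Qed.

End poisson_limit.

(** * Convergence in probability of the ratio *)

Section concentration.
Context {R : realType}.
Variables (lambda rho : R) (k N : nat).
Variable pr : forall n, {set 'I_n * 'I_n} -> R.
Hypothesis l0 : 0 < lambda.
Hypothesis rg : forall n, (N <= n)%N ->
  random_graph (@pr n) (lambda / n%:R) (lambda ^+ 2 * rho / n%:R ^+ 2).

Local Notation c := (annd_limit lambda rho k).

Lemma cvg_annd_edges eps : 0 < eps ->
  \sum_(E | eps < `|annd_edges k.+1 E - c|) @pr n E @[n --> \oo] --> (0 : R).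
Proof.
move=> e0.
pose K := k.+1%:R * c.
(* Half the limiting frequency of degree [k.+1], hence eventually a lower bound for [binpmf]. *)
pose delta := poisson lambda k.+1 / 2.
have d0 : 0 < delta by rewrite divr_gt0// poisson_gt0.
(* When the count exceeds [delta / 2 * n], an error above [eps] in the ratio forces [full_sum] above
   [eta * n]. *)
pose eta := eps * k.+1%:R * (delta / 2).
have eta0 : 0 < eta by apply: mulr_gt0; [rewrite mulr_gt0 ?ltr0n|rewrite divr_gt0].
apply/cvgrPdist_le => e e1.
pose B := 4 * expR lambda.
have B0 : 0 < B by rewrite mulr_gt0// expR_gt0.
(* Four contributions of size [zeta / eta] add up to [e]: one for a small count, and three for the
   mean, the truncation and the variance of [full_sum]. *)
pose zeta := e * eta / 4.
have z0 : 0 < zeta by rewrite divr_gt0// mulr_gt0.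
(* Makes the truncation error [2 * B / M] at most [zeta], independently of [n]. *)
pose M := (Num.truncn (2 * B / zeta)).+1.
have M0 : (0 < M)%N by [].
pose C := (2 * ((k.+1 * M)%:R + `|K|) + M%:R) ^+ 2.
have cv0 : binpmf (lambda / n%:R) (n - 1) k.+1 @[n --> \oo] --> poisson lambda k.+1.
  exact: cvg_binpmf.
have cv1 : 16 * B / (delta ^+ 2 * n%:R) @[n --> \oo] --> (0 : R).
  apply: (@cvg_near_eq _ (fun n => 16 * B / delta ^+ 2 * n%:R^-1) _ (16 * B / delta ^+ 2 * 0)).
  - by apply: cvgM; [exact: cvg_cst|exact: cvg_natinv].
  - by rewrite mulr0.
  - by apply: nearW => n; rewrite invfM mulrA.
have cv2 : C * B / (zeta * n%:R) @[n --> \oo] --> (0 : R).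
  apply: (@cvg_near_eq _ (fun n => C * B / zeta * n%:R^-1) _ (C * B / zeta * 0)).
  - by apply: cvgM; [exact: cvg_cst|exact: cvg_natinv].
  - by rewrite mulr0.
  - by apply: nearW => n; rewrite invfM mulrA.
near=> n.
have n0 : (0 < n)%N by near: n; exact: nbhs_infty_gt.
have n0' : 0 < n%:R :> R by rewrite ltr0n.
have Nn : (N <= n)%N by near: n; exact: nbhs_infty_ge.
have r := rg Nn.
have qB : 4 * (1 + lambda / n%:R) ^+ n.-1 <= B by rewrite ler_pM2l// exp_mean_degree_le.
have db : delta <= binpmf (lambda / n%:R) n.-1 k.+1.
  rewrite -subn1; near: n; apply: (cvgr_ge _ cv0).
  by rewrite ltr_pdivrMr// ltr_pMr ?poisson_gt0// ltr1n.
have p1 : \sum_(E | count_deg k.+1 E <= delta / 2 * n%:R) @pr n E <= zeta / eta.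
  apply: (le_trans (prob_count_deg r n0 (ltn0Sn k) d0 db)).
  apply: (@le_trans _ _ (16 * B / (delta ^+ 2 * n%:R))).
    have w0 : 0 < delta ^+ 2 * n%:R by rewrite mulr_gt0 ?exprn_gt0.
    by rewrite ler_pM2r ?invr_gt0// ler_pM2l.
  near: n; apply: (cvgr_le _ cv1); by rewrite divr_gt0.
have m1 : `|Ex (@pr n) (full_sum k.+1 K)| / n%:R <= zeta.
  rewrite (Ex_full_sum r) normrM (gtr0_norm n0') mulrAC divff ?gt_eqF// mul1r.
  rewrite -normrN -sub0r; near: n.
  by move/cvgrPdist_le : (@cvg_full_sum_mean _ lambda rho k); apply.
have p2 : \sum_(E | eta * n%:R < `|full_sum k.+1 K E|) @pr n E <= 3 * (zeta / eta).
  apply: (le_trans (prob_full_sum r K n0 (ltn0Sn k) M0 eta0 z0)).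
  rewrite [leRHS]mulrA ler_pM2r ?invr_gt0//.
  have h1 : 2 * (4 * (1 + lambda / n%:R) ^+ n.-1) / M%:R <= zeta.
    rewrite ler_pdivrMr ?ltr0n//; apply: (@le_trans _ _ (2 * B)).
      by rewrite ler_pM2l.
    rewrite [leRHS]mulrC -ler_pdivrMr// ltW// /M.
    exact: truncnS_gt.
  have h2 : C * (4 * (1 + lambda / n%:R) ^+ n.-1) / (zeta * n%:R) <= zeta.
    apply: (@le_trans _ _ (C * B / (zeta * n%:R))).
      have w0 : 0 < zeta * n%:R by rewrite mulr_gt0.
      by rewrite ler_pM2r ?invr_gt0// ler_wpM2l// sqr_ge0.
    by near: n; exact: (cvgr_le _ cv2).
  rewrite -/C; move: m1 h1 h2; lra.
rewrite sub0r normrN ger0_norm; last by apply: sumr_ge0 => E _; exact: rg_ge0 r _.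
apply: (@le_trans _ _ (\sum_(E | count_deg k.+1 E <= delta / 2 * n%:R) @pr n E +
    \sum_(E | eta * n%:R < `|full_sum k.+1 K E|) @pr n E)).
  rewrite big_mkcond [X in X + _]big_mkcond [X in _ + X]big_mkcond -big_split/=.
  apply: ler_sum => E _; have prE := rg_ge0 r E.
  case: ifPn => [annE|_]; last by rewrite addr_ge0//; case: ifP.
  case: (leP (count_deg k.+1 E) (delta / 2 * n%:R)) => cE; first by rewrite lerDl; case: ifP.
  rewrite add0r ifT//.
  have c0 : (0 : R) < count_deg k.+1 E by rewrite (le_lt_trans _ cE)// mulr_ge0// divr_ge0// ltW.
  have k0 : (0 : R) < k.+1%:R * count_deg k.+1 E by rewrite mulr_gt0.
  have -> : full_sum k.+1 K E = (annd_edges k.+1 E - c) * (k.+1%:R * count_deg k.+1 E).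
    rewrite mulrBl divfK ?gt_eqF// mulrA [c * _]mulrC -/K mulr_sumr -sumrB.
    by apply: eq_bigr => u _; rewrite mulrBr [K * _]mulrC.
  rewrite normrM (gtr0_norm k0).
  have -> : eta * n%:R = eps * (k.+1%:R * (delta / 2 * n%:R)) by rewrite /eta !mulrA.
  apply: (@lt_trans _ _ (eps * (k.+1%:R * count_deg k.+1 E))); last by rewrite ltr_pM2r.
  by rewrite ltr_pM2l// ltr_pM2l ?ltr0n.
apply: (le_trans (lerD p1 p2)).
rewrite /zeta le_eqVlt; apply/orP; left; apply/eqP; field.
by rewrite gt_eqF.
Unshelve. all: by end_near. Qed.

End concentration.

(** * Volume of Euclidean balls *)

Section lebesgue_affine.
Context {R : realType}.
Local Notation leb := (@lebesgue_measure R).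

Definition affine (c b : R) (t : measurableTypeR R) : measurableTypeR R := c * t + b.

Lemma measurable_affine c b : measurable_fun setT (affine c b).
Proof. by apply: measurable_funD => //; exact: measurable_funM. Qed.

HB.instance Definition _ c b :=
  isMeasurableFun.Build _ _ _ _ (affine c b) (@measurable_affine c b).

Lemma lebesgue_affine (c b : R) (c0 : 0 < c) (A : set R) : measurable A ->
  (c%:E * leb (affine c b @^-1` A) = leb A)%E.
Proof.
move=> mA; have c0' : 0 <= c by exact: ltW.
transitivity (pushforward (mscale (NngNum c0') leb) (affine c b) A) => //.
apply/esym/lebesgue_measure_unique => //= _ [[x y]] _ <-.
rewrite /pushforward /mscale/=.
rewrite (_ : _ @^-1` _ = `]((x - b) / c), ((y - b) / c)]%classic); last first.
  apply/seteqP; split => t /=; rewrite !in_itv/= /affine ltr_pdivrMr// ler_pdivlMr//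
    ltrBlDr lerBrDr [c * t]mulrC//.
rewrite !lebesgue_measure_itv/= !lte_fin ltr_pM2r ?invr_gt0// ltrD2r.
case: ifP => _; last by rewrite mule0.
by rewrite -!EFinD -EFinM; congr EFin; field; rewrite gt_eqF.
Qed.

Lemma lebesgue_shift (b : R) (A : set R) : measurable A ->
  leb [set t | A (t + b)] = leb A.
Proof.
move=> mA; rewrite -[RHS](lebesgue_affine b ltr01)// mul1e; congr (leb _).
by apply/seteqP; split => t /=; rewrite /affine mul1r.
Qed.

Lemma lebesgue_reflect (a : R) (A : set R) : measurable A ->
  leb [set t | A (a - t)] = leb A.
Proof.
move=> mA; rewrite -[RHS](lebesgue_shift a)// -[RHS]lebesgue_measureN; last first.
  rewrite -[X in measurable X]setTI.
  rewrite (_ : [set t | _] = affine 1 a @^-1` A); last first.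
    by apply/seteqP; split => t /=; rewrite /affine mul1r.
  exact: measurable_affine.
by congr (leb _); apply/seteqP; split => t /=; rewrite addrC.
Qed.

Lemma measurable_shift (b : R) (A : set R) : measurable A -> measurable [set t | A (t + b)].
Proof.
move=> mA; rewrite (_ : [set t | _] = affine 1 b @^-1` A); last first.
  by apply/seteqP; split => t /=; rewrite /affine mul1r.
by rewrite -[X in measurable X]setTI; exact: measurable_affine.
Qed.

(** Absorbs a boundary point: the torus box is closed, while [wrap] takes values in a half-open
    interval. *)
Lemma lebesgue_setD1 (x : R) (A B : set R) : measurable A -> measurable B ->
  A `<=` B -> B `<=` A `|` [set x] -> leb A = leb B.
Proof.
move=> mA mB AB BA; apply/eqP; rewrite eq_le; apply/andP; split.
  by apply: le_measure; rewrite ?inE.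
apply: (@le_trans _ _ (leb (A `|` [set x]))).
  by apply: le_measure; rewrite ?inE//; exact: measurableU.
apply: (le_trans (measureU2 leb mA (measurable_set1 x))).
rewrite [X in (_ + X)%E](_ : _ = 0%E) ?adde0//; exact: lebesgue_measure_set1.
Qed.

Variable L : R.
Hypothesis L0 : 0 < L.

(** The representative of [t] modulo [L] in [[- (L / 2), L / 2[]: the floor selects the nearest
    multiple of [L], ties going up. *)
Definition wrap (t : R) : R := t - L * (Num.floor (t / L + 2^-1))%:~R.

Lemma wrap_itv t : - (L / 2) <= wrap t < L / 2.
Proof.
have /andP[h1 h2] := floor_itv (t / L + 2^-1).
rewrite /wrap; set k := Num.floor _ in h1 h2 *.
move: h1 h2; rewrite intrD -lerBlDr ler_pdivlMr// -ltrBrDr ltr_pdivrMr// => h1 h2.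
apply/andP; split; lra.
Qed.

Lemma wrapE t (k : int) : - (L / 2) <= t - L * k%:~R < L / 2 -> wrap t = t - L * k%:~R.
Proof.
move=> /andP[h1 h2]; rewrite /wrap (@floor_def _ _ k)// intrD.
rewrite -lerBlDr ler_pdivlMr// -ltrBrDr ltr_pdivrMr//.
by apply/andP; split; lra.
Qed.

Lemma wrap_id t : - (L / 2) <= t < L / 2 -> wrap t = t.
Proof. by move=> h; rewrite (@wrapE t 0) mulr0 subr0. Qed.

Lemma wrapD t (k : int) : wrap (t + L * k%:~R) = wrap t.
Proof.
have := wrap_itv t; rewrite [wrap t]/wrap; set j := Num.floor _ => h.
have E : t + L * k%:~R - L * (j + k)%:~R = t - L * j%:~R by rewrite intrD; ring.
by rewrite (@wrapE _ (j + k)) E.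
Qed.

(** Any other translate differs from [wrap t] by at least [L], while [wrap t] is at most [L / 2] in
    absolute value. *)
Lemma wrap_min t (k : int) : `|wrap t| <= `|t - L * k%:~R|.
Proof.
have /andP[h1 h2] := wrap_itv t.
have [->//|ne] : `|wrap t| = `|t - L * k%:~R| \/ Num.floor (t / L + 2^-1) - k != 0.
  by case: eqVneq => [/eqP|]; [rewrite subr_eq0 => /eqP <-; left|right].
have -> : t - L * k%:~R = wrap t + L * (Num.floor (t / L + 2^-1) - k)%:~R.
  by rewrite /wrap intrB; ring.
set w := wrap t in h1 h2 *; set j := _ - k in ne *.
have w2 : `|w| <= L / 2 by rewrite ler_norml h1 ltW.
have := ler_normB (w + L * j%:~R) w; rewrite addrAC subrr add0r.
have : L <= `|L * j%:~R|.
  have j1 : 1 <= `|j%:~R| :> R by rewrite -intr_norm ler1z -gtz0_ge1 normr_gt0.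
  by rewrite normrM (gtr0_norm L0) ler_peMr// ltW.
by move: w2; lra.
Qed.

Lemma measurable_wrap : measurable_fun setT wrap.
Proof.
apply: measurable_funB => //; apply: measurable_funM => //.
apply: (measurableT_comp (f := fun t : R => (Num.floor t)%:~R : R)).
  by apply: nondecreasing_measurable => // x y xy; rewrite ler_int; exact: le_floor.
by apply: measurable_funD => //; exact: measurable_funM.
Qed.

(** Reflection turns the box into a period centred at [a]. The single point of L/2 + L Z at which
    wrapping jumps cuts that period into two pieces, and shifting them by [m] and [m + 1] periods
    tiles the box again. *)
Lemma lebesgue_wrap a (A : set R) : measurable A ->
  leb [set t | (- (L / 2) <= t <= L / 2) && `[< A (wrap (a - t)) >]] =
  leb [set t | (- (L / 2) <= t <= L / 2) && `[< A t >]].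
Proof.
move=> mA.
pose m := Num.floor (a / L).
have /andP[m1 m2] := floor_itv (a / L); rewrite -/m in m1 m2.
move: m1 m2; rewrite intrD ler_pdivlMr// ltr_pdivrMr// => m1 m2.
(* The place in the box where the left end [a - L / 2] of the period lands. *)
pose b := a - L / 2 - L * m%:~R.
have mI x y : measurable (`[x, y[ `&` A) by exact: measurableI.
have mW : measurable [set t | A (wrap t)].
  rewrite (_ : [set t | _] = wrap @^-1` A)//.
  by rewrite -[X in measurable X]setTI; exact: measurable_wrap.
have mr (B : set R) : measurable B -> measurable [set t | B (a - t)].
  move=> mB; rewrite (_ : [set t | _] = (fun t => a - t) @^-1` B)//.
  rewrite -[X in measurable X]setTI.
  by apply: measurable_funB.
transitivity (leb ([set t | (`[a - L / 2, a + L / 2[ `&` [set t | A (wrap t)]) (a - t)])).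
  apply/esym/(@lebesgue_setD1 (- (L / 2))).
  - by apply: mr; exact: measurableI.
  - rewrite (_ : [set t | _] = `[- (L / 2), L / 2] `&` [set t | A (wrap (a - t))]).
      by apply: measurableI => //; exact: (mr _ mW).
    apply/seteqP; split => t /=; rewrite in_itv/=; first by move=> /andP[-> /asboolP].
    by move=> [-> /asboolP ->].
  - move=> t /= []; rewrite in_itv/= => /andP[h1 h2] At; apply/andP; split; last exact/asboolP.
    by apply/andP; split; lra.
  - move=> t /= /andP[/andP[h1 h2] /asboolP At].
    have [->|ne] := eqVneq t (- (L / 2)); [by right|left].
    split => //; rewrite in_itv/=; have : - (L / 2) < t by rewrite lt_neqAle eq_sym ne.
    by move=> h3; apply/andP; split; lra.
rewrite lebesgue_reflect; last exact: measurableI.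
have sh (k : int) (B : set R) : measurable B -> leb [set t | B (t - L * k%:~R)] = leb B.
  by move=> mB; rewrite -[RHS](lebesgue_shift (- (L * k%:~R))).
pose U : set R := `[b, L / 2[ `&` A.
pose V : set R := `[- (L / 2), b[ `&` A.
have mU : measurable U by exact: mI.
have mV : measurable V by exact: mI.
transitivity (leb U + leb V)%E.
  rewrite -(sh m U)// -(sh (m + 1) V)// /U /V.
  rewrite -measureU; last 3 first.
  - exact: measurable_shift.
  - exact: measurable_shift.
  - apply/seteqP; split => // t /= [[]]; rewrite !in_itv/= /b intrD => /andP[h1 h2] _ [/andP[h3 h4] _].
    by lra.
  congr (leb _); apply/seteqP; split => t /=.
    rewrite !in_itv/= => -[/andP[h1 h2] At].
    have [h|h] := ltP t (L / 2 + L * m%:~R).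
      left; rewrite (@wrapE t m) in At; last by apply/andP; split; lra.
      by split => //; rewrite /b; apply/andP; split; lra.
    right; rewrite (@wrapE t (m + 1)) in At; last by rewrite intrD; apply/andP; split; lra.
    by split => //; rewrite /b intrD; apply/andP; split; lra.
  rewrite !in_itv/= /b => -[[/andP[h1 h2] At]|[/andP[h1 h2] At]].
    rewrite (@wrapE t m); last by apply/andP; split; lra.
    by split => //; apply/andP; split; lra.
  rewrite (@wrapE t (m + 1)); last by rewrite intrD in h1 h2 *; apply/andP; split; lra.
  by rewrite intrD in h1 h2; split => //; apply/andP; split; lra.
rewrite -measureU//; last first.
  apply/seteqP; split => // t; rewrite /U /V /= !in_itv/=.
  by move=> [[/andP[h1 h2] _] [/andP[h3 h4] _]]; lra.
apply: (@lebesgue_setD1 (L / 2)).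
- exact: measurableU.
- rewrite (_ : [set t | _] = `[- (L / 2), L / 2] `&` A); first exact: measurableI.
  apply/seteqP; split => t /=; rewrite in_itv/=; first by move=> /andP[-> /asboolP].
  by move=> [-> /asboolP ->].
- move=> t; rewrite /U /V /= !in_itv/= /b => -[] [/andP[h1 h2] At]; apply/andP; split; do ?exact/asboolP;
    by apply/andP; split; lra.
- move=> t /= /andP[/andP[h1 h2] /asboolP At].
  have [->|ne] := eqVneq t (L / 2); [by right|left].
  have h3 : t < L / 2 by rewrite lt_neqAle ne.
  rewrite /U /V /= !in_itv/=; have [h|h] := leP b t; first by left; split => //; apply/andP; split.
  by right; split => //; apply/andP; split.
Qed.

End lebesgue_affine.

(** * Scaling of volume, the Gaussian integral and the volume of a ball *)

Section volume_integrals.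
Context {R : realType}.
Local Notation leb := (@lebesgue_measure R).
Local Notation vol := (@volume R).

Lemma ge0_integral_volumeS d (f : d.+1.-tuple R -> \bar R) :
  measurable_fun setT f -> (forall x, (0 <= f x)%E) ->
  (\int[vol d.+1]_x f x = \int[leb]_t \int[vol d]_y f (cons_point (t, y)))%E.
Proof.
move=> mf f0.
transitivity (\int[pushforward (leb \x vol d)%E (@cons_point R d)]_x f x)%E.
  by apply: eq_measure_integral => //=; exact: measurable_cons_point.
rewrite ge0_integral_pushforward//; last exact: measurable_cons_point.
rewrite preimage_setT fubini_tonelli1//.
  by apply: measurableT_comp => //; exact: measurable_cons_point.
by move=> z; exact: f0.
Qed.

Definition dilate d (c : R) (x : d.-tuple R) : d.-tuple R := [tuple c * tnth x i | i < d].

Lemma measurable_dilate d c : measurable_fun setT (@dilate d c).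
Proof.
apply/measurable_fun_tnthP => i; rewrite (_ : _ \o _ = fun x => c * tnth x i).
  by apply: measurable_funM => //; exact: measurable_tnth.
by apply/funext => x; rewrite /= tnth_mktuple.
Qed.

Definition cube d (k : nat) (i : 'I_d) : set R := `[- k%:R, k%:R]%classic.

Lemma volume_dilate d (c : R) (A : set (d.-tuple R)) : 0 < c -> measurable A ->
  ((c ^+ d)%:E * vol d (dilate c @^-1` A) = vol d A)%E.
Proof.
move=> c0 mA; have cd0 : 0 <= c ^+ d by rewrite exprn_ge0// ltW.
transitivity (pushforward (mscale (NngNum cd0) (vol d)) (@dilate d c) A) => //.
have mcube k i : measurable (@cube d k i) by exact: measurable_itv.
apply/esym/(@tuple_measure_unique _ _ _ _ _ _ (@cube d)) => //=.
- exact: measurable_dilate.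
- apply/seteqP; split => // x _.
  have [k kx] : exists k : nat, \sum_(i < d) `|tnth x i| <= k%:R.
    by exists (Num.truncn (\sum_(i < d) `|tnth x i|)).+1; apply/ltW/truncnS_gt.
  exists k => // i; rewrite /cube/= in_itv/= -ler_norml (le_trans _ kx)//.
  by rewrite (bigD1 i)//= lerDl sumr_ge0.
- move=> k; rewrite volume_box//.
  rewrite (eq_bigr (fun=> (k%:R + k%:R)%:E)); last first.
    move=> i _; rewrite /cube lebesgue_measure_itv/= lte_fin.
    case: ltP => [_|k0]; first by rewrite -EFinD opprK.
    congr EFin; apply/eqP; rewrite eq_sym paddr_eq0// andbb eq_le ler0n andbT.
    by move: k0; lra.
  by rewrite prodEFin ltry.
move=> _ B mB; rewrite volume_box// /pushforward /mscale/=.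
have mcB i : measurable [set t | B i (c * t)].
  rewrite -[X in measurable X]setTI (_ : [set t | _] = affine c 0 @^-1` (B i)).
    exact: (@measurable_affine R c 0 measurableT (B i) (mB i)).
  by apply/seteqP; split => t /=; rewrite /affine addr0.
rewrite (_ : _ @^-1` _ = [set x | forall i, [set t | B i (c * t)] (tnth x i)]); last first.
  by apply/seteqP; split => x H i; have := H i; rewrite /= tnth_mktuple.
rewrite (volume_box (A := fun i => [set t | B i (c * t)]) mcB).
transitivity (\prod_(i < d) (c%:E * leb [set t | B i (c * t)%R]))%E.
  apply: eq_bigr => i _; rewrite -[LHS](lebesgue_affine 0 c0)//; congr (_ * leb _)%E.
  by apply/seteqP; split => t /=; rewrite /affine addr0.
rewrite big_split/=; congr (_ * _)%E.
by rewrite prodEFin prodr_const card_ord.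
Qed.

Lemma enorm_ge0 d (x : d.-tuple R) : 0 <= enorm x. Proof. exact: sqrtr_ge0. Qed.

Lemma enorm_sqr d (x : d.-tuple R) : enorm x ^+ 2 = \sum_(i < d) tnth x i ^+ 2.
Proof. by rewrite sqr_sqrtr// sumr_ge0// => i _; exact: sqr_ge0. Qed.

Lemma measurable_enorm d : measurable_fun setT (@enorm R d).
Proof.
apply: (measurableT_comp (f := @Num.sqrt R)).
  by apply: nondecreasing_measurable => // x y; exact: ler_wsqrtr.
by apply: measurable_sum => i; apply: measurable_funX; exact: measurable_tnth.
Qed.

Lemma measurable_le_fun d (T : measurableType d) (f g : T -> R) :
  measurable_fun setT f -> measurable_fun setT g -> measurable [set x | f x <= g x].
Proof.
move=> mf mg.
rewrite (_ : [set x | _] = (fun x => f x <= g x) @^-1` [set true]); last first.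
  by apply/seteqP; split.
rewrite -[X in measurable X]setTI.
by have := measurable_fun_ler mf mg; apply.
Qed.

Lemma measurable_eball d r : measurable (@eball R d r).
Proof. by apply: measurable_le_fun => //; exact: measurable_enorm. Qed.

Lemma enorm_dilate d c (x : d.-tuple R) : 0 <= c -> enorm (dilate c x) = c * enorm x.
Proof.
move=> c0; rewrite /enorm -[X in X * _](ger0_norm c0) -sqrtr_sqr -sqrtrM ?sqr_ge0//.
by congr Num.sqrt; rewrite mulr_sumr; apply: eq_bigr => i _; rewrite tnth_mktuple exprMn.
Qed.

Lemma volume_eball d r : 0 < r ->
  vol d (@eball R d r) = ((r ^+ d)%:E * vol d (@eball R d 1))%E.
Proof.
move=> r0; rewrite -(@volume_dilate d r _ r0); last exact: measurable_eball.
congr (_ * vol d _)%E; apply/seteqP; split => x; rewrite /eball/= enorm_dilate ?(ltW r0)//.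
  by rewrite -ler_pdivlMl// mulVf ?gt_eqF.
by move=> h; rewrite ler_piMr ?(ltW r0).
Qed.

Lemma measurable_exp_enorm d :
  measurable_fun setT (fun x : d.-tuple R => (expR (- enorm x ^+ 2))%:E).
Proof.
apply/measurable_EFinP; apply: (measurableT_comp (f := @expR R)) => //.
apply: measurable_funN; apply: measurable_funX; exact: measurable_enorm.
Qed.

Lemma gaussian_volume d :
  (\int[vol d]_x (expR (- enorm x ^+ 2))%:E = (Num.sqrt pi ^+ d)%:E)%E.
Proof.
elim: d => [|d IH].
  rewrite integral_dirac//; last exact: measurable_exp_enorm.
  by rewrite diracT mul1e enorm_sqr big_ord0 oppr0 expR0 expr0.
have e0 m (x : m.-tuple R) : (0 <= (expR (- enorm x ^+ 2))%:E)%E by rewrite lee_fin expR_ge0.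
rewrite (ge0_integral_volumeS (@measurable_exp_enorm d.+1))//.
transitivity (\int[leb]_t ((gauss_fun t)%:E * (Num.sqrt pi ^+ d)%:E))%E.
  have g0 t : (0 <= (gauss_fun t)%:E :> \bar R)%E by rewrite lee_fin gauss_fun_ge0.
  apply: eq_integral => t _; rewrite -IH.
  rewrite -(ge0_integralZl (vol d) measurableT (@measurable_exp_enorm d) (fun x _ => e0 d x) (g0 t)).
  apply: eq_integral => y _; rewrite -EFinM /gauss_fun -expRD; congr (expR _)%:E.
  rewrite !enorm_sqr big_ord_recl -opprD; congr (- (_ + _)).
  by apply: eq_bigr => i _; rewrite tnth_cons_point.
have g0 t : (0 <= (gauss_fun t)%:E :> \bar R)%E by rewrite lee_fin gauss_fun_ge0.
have mg : measurable_fun setT (fun t : R => (gauss_fun t)%:E).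
  by apply/measurable_EFinP; exact: measurable_gauss_fun.
have s0 : (0 <= (Num.sqrt pi ^+ d)%:E :> \bar R)%E by rewrite lee_fin exprn_ge0// sqrtr_ge0.
rewrite (ge0_integralZr leb measurableT mg (fun t _ => g0 t) s0).
by rewrite integralT_gauss -EFinM exprS.
Qed.

Lemma exp_tail (s : R) : (\int[leb]_(t in `[s, +oo[) (expR (- t))%:E = (expR (- s))%:E)%E.
Proof.
have cE : continuous (fun t : R => expR (- t)).
  by move=> t; apply: continuous_comp; [exact: opp_continuous|exact: continuous_expR].
rewrite (@ge0_continuous_FTC2y _ _ (fun t => - expR (- t)) s 0).
- by rewrite EFinN oppeK add0e.
- by move=> t _; exact: expR_ge0.
- exact: continuous_subspaceT.
- by rewrite -oppr0; apply: cvgN; exact: cvgr_expR.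
- by move=> t _; exact: ex_derive.
- by apply: cvgN; apply: cvg_at_right_filter; exact: cE.
- move=> t _; rewrite derive1E deriveN// -derive1E derive1_comp// derive1N// derive1_id.
  rewrite mulrN1 opprK derive1E; by have /funeqP -> := @derive_expR R.
Qed.

(** Rules out zero times infinity, so that the ball volume and the Gamma integral are seen to be
    finite and positive from their product alone. *)
Lemma muleFin_gt0 (x y : \bar R) (a : R) : (0 <= x)%E -> (0 <= y)%E -> 0 < a ->
  (x * y = a%:E)%E -> exists b c : R, [/\ x = b%:E, y = c%:E, 0 < b & 0 < c].
Proof.
move=> x0 y0 a0; case: x x0 => [b| |]//; case: y y0 => [c| |]//.
- rewrite !lee_fin -EFinM => c0 b0 [ab].
  exists b, c; split => //; rewrite lt_neqAle ?c0 ?b0 andbT eq_sym; apply/eqP => h0;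
    by rewrite -ab h0 ?mul0r ?mulr0 ltxx in a0.
- move=> _; rewrite lee_fin le_eqVlt => /predU1P[<-|b0].
    by rewrite mul0e => -[h]; rewrite -h ltxx in a0.
  by rewrite gt0_muley ?lte_fin.
- rewrite lee_fin le_eqVlt => /predU1P[<-|c0] _.
    by rewrite mule0 => -[h]; rewrite -h ltxx in a0.
  by rewrite gt0_mulye ?lte_fin.
Qed.

Lemma integral_bool d (T : measurableType d) (mu : {measure set T -> \bar R})
    (b : T -> bool) : measurable [set x | b x] ->
  (\int[mu]_x ((b x)%:R)%:E = mu [set x | b x])%E.
Proof.
move=> mb; rewrite -[in RHS](setIT [set x | b x]) -integral_indic//.
by apply: eq_integral => x _; rewrite indicE in_setE_bool.
Qed.

(** The condition [0 < t] restricts to the domain of the Gamma integral; it costs at most the null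
    set containing 0. *)
Lemma exp_tail_gt0 (s : R) : 0 <= s ->
  (\int[leb]_t (((s <= t)%R && (0 < t)%R)%:R * expR (- t))%:E = (expR (- s))%:E)%E.
Proof.
move=> s0; rewrite -exp_tail.
transitivity (\int[leb]_(t in [set` Interval (if (s == 0)%R then BRight s else BLeft s) +oo%O])
    (expR (- t))%:E)%E.
  rewrite [RHS]integral_mkcond; apply: eq_integral => t _.
  rewrite patchE mem_setE; case: eqVneq => [->|sn]; rewrite in_itv/= andbT.
    by case: ltP => t0; rewrite ?(ltW t0) ?andbF ?mul1r ?mul0r.
  case: (leP s t) => st /=; last by rewrite mul0r.
  by rewrite (lt_le_trans _ st) ?mul1r// lt_neqAle eq_sym sn.
case: eqVneq => // _; rewrite integral_itv_obnd_cbnd//.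
apply/measurable_EFinP/measurable_funTS.
by apply: (measurableT_comp (f := @expR R)) => //; exact: measurable_funN.
Qed.

(* Layer cake: exp(-|x|^2) is the integral of exp(-t) over t >= |x|^2. *)
Lemma gaussian_layer_cake d :
  (\int[vol d]_x (expR (- enorm x ^+ 2))%:E = vol d (@eball R d 1) *
   \int[leb]_(t in `]0%R, +oo[) (t `^ (1 + d%:R / 2 - 1) * expR (- t))%:E)%E.
Proof.
pose b (z : d.-tuple R * measurableTypeR R) := (enorm z.1 ^+ 2 <= z.2)%R && (0 < z.2)%R.
pose h z : \bar R := ((b z)%:R * expR (- z.2))%:E.
have mb : measurable [set z | b z].
  rewrite (_ : [set z | b z] = [set z | enorm z.1 ^+ 2 <= z.2] `&` snd @^-1` `]0, +oo[%classic).
    apply: measurableI.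
      apply: measurable_le_fun; last exact: measurable_snd.
      apply: measurable_funX; exact: measurableT_comp (@measurable_enorm d) _.
    by rewrite -[X in measurable X]setTI; apply: measurable_snd.
  by apply/seteqP; split => z /=; rewrite /b in_itv/= andbT; [move/andP|move=> [-> ->]].
have mh : measurable_fun setT h.
  apply/measurable_EFinP; apply: measurable_funM; first exact: (proj1 (bmeas_bool mb)).
  apply: (measurableT_comp (f := @expR R)) => //.
  by apply: measurable_funN; exact: measurable_snd.
have h0 z : (0 <= h z)%E by rewrite lee_fin mulr_ge0// expR_ge0.
transitivity (\int[vol d]_x \int[leb]_t h (x, t))%E.
  by apply: eq_integral => x _; rewrite -exp_tail_gt0// sqr_ge0.
rewrite fubini_tonelli// [in RHS]integral_mkcond.
pose F t : R := t `^ (1 + d%:R / 2 - 1) * expR (- t).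
have F0 t : 0 <= F t by rewrite mulr_ge0 ?powR_ge0 ?expR_ge0.
have mF : measurable_fun setT F.
  apply: measurable_funM; first exact: measurable_powR.
  by apply: (measurableT_comp (f := @expR R)) => //; exact: measurable_funN.
rewrite -ge0_integralZl//; [|by apply/(measurable_restrict _ _ _).1 => //; exact/measurable_EFinP/measurable_funTS|]; last first.
  by move=> t _; rewrite patchE; case: ifP => // _; rewrite lee_fin F0.
apply: eq_integral => t _; rewrite patchE mem_setE in_itv/= andbT.
have [t0|t0] := ltP 0 t; last first.
  rewrite mule0 integral0_eq// => x _; rewrite /h /b/= (leNgt _ 0) in t0 *.
  by rewrite /h /b/= (negbTE t0) andbF mul0r.
rewrite /h /b/= t0.
transitivity (\int[vol d]_x ((enorm x ^+ 2 <= t)%R%:R%:E * (expR (- t))%:E))%E.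
  by apply: eq_integral => x _; rewrite andbT EFinM.
have mt : measurable [set x : d.-tuple R | enorm x ^+ 2 <= t].
  by apply: measurable_le_fun => //; apply: measurable_funX; exact: measurable_enorm.
have mb' : measurable_fun setT (fun x : d.-tuple R => (enorm x ^+ 2 <= t)%R%:R%:E : \bar R).
  by apply/measurable_EFinP; exact: (proj1 (bmeas_bool mt)).
have b0 (x : d.-tuple R) : (0 <= (enorm x ^+ 2 <= t)%R%:R%:E :> \bar R)%E by rewrite lee_fin.
have e0 : (0 <= (expR (- t))%:E)%E by rewrite lee_fin expR_ge0.
rewrite (ge0_integralZr (vol d) measurableT mb' (fun x _ => b0 x) e0).
rewrite integral_bool// (_ : [set x | _] = @eball R d (Num.sqrt t)); last first.
  apply/seteqP; split => x; rewrite /eball/= => xt.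
    by rewrite -(ger0_norm (enorm_ge0 x)) -sqrtr_sqr ler_wsqrtr.
  by rewrite -(sqr_sqrtr (ltW t0)) ler_pXn2r ?nnegrE ?enorm_ge0// sqrtr_ge0.
(* The ball of radius [Num.sqrt t] scales as t^(d/2), which is the power in the Gamma integral at 1
   + d/2. *)
have -> : t `^ (1 + d%:R / 2 - 1) * expR (- t) = Num.sqrt t ^+ d * expR (- t).
  rewrite [1 + _]addrC addrK; congr (_ * _).
  by rewrite -powR12_sqrt ?ltW// -powR_mulrn ?powR_ge0// -powRrM mulrC.
transitivity ((Num.sqrt t ^+ d)%:E * vol d (@eball R d 1) * (expR (- t))%:E)%E.
  by congr (_ * _)%E; apply: volume_eball; rewrite sqrtr_gt0.
by rewrite EFinM -[LHS]muleA [RHS]muleCA.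
Qed.

Lemma volume_ball d r : 0 < r ->
  vol d (@eball R d r) = (omega d r)%:E /\ 0 < omega d r :> R.
Proof.
move=> r0; have := gaussian_layer_cake d; rewrite gaussian_volume => /esym.
have sd : 0 < Num.sqrt pi ^+ d :> R by rewrite exprn_gt0// sqrtr_gt0 pi_gt0.
have F0 t : (0 <= (t `^ (1 + d%:R / 2 - 1) * expR (- t))%:E :> \bar R)%E.
  by rewrite lee_fin mulr_ge0 ?powR_ge0 ?expR_ge0.
move=> vG; have [|v [g [vE gE v0 g0]]] := muleFin_gt0 (measure_ge0 _ _) _ sd vG.
  by apply: integral_ge0 => t _; exact: F0.
have oE : omega d r = r ^+ d * v.
  rewrite /omega /Gamma /Rintegral gE mulrC; congr (_ * _).
  move: vG; rewrite vE gE -EFinM => -[vgE].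
  apply: (mulIf (lt0r_neq0 g0)); rewrite divfK ?gt_eqF// vgE.
  by rewrite -powR12_sqrt ?pi_ge0// -powR_mulrn ?powR_ge0// -powRrM mulrC.
by split; [rewrite volume_eball// vE oE|rewrite oE mulr_gt0// exprn_gt0].
Qed.

End volume_integrals.

(** * The torus *)

Section torus_metric.
Context {R : realType}.
Implicit Types L : R.

Lemma le_enorm d (x y : d.-tuple R) :
  (forall i, `|tnth x i| <= `|tnth y i|) -> enorm x <= enorm y.
Proof.
move=> xy; rewrite /enorm ler_wsqrtr// ler_sum// => i _.
rewrite -[leLHS]real_normK ?num_real// -[leRHS]real_normK ?num_real//.
by rewrite ler_pXn2r ?nnegrE.
Qed.

Lemma eq_enorm d (x y : d.-tuple R) :
  (forall i, `|tnth x i| = `|tnth y i|) -> enorm x = enorm y.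
Proof.
by move=> xy; apply/eqP; rewrite eq_le; apply/andP; split; apply: le_enorm => i; rewrite xy.
Qed.

Lemma tnth_le_enorm d (x : d.-tuple R) i : `|tnth x i| <= enorm x.
Proof.
rewrite -sqrtr_sqr ler_wsqrtr// (bigD1 i)//= lerDl sumr_ge0// => j _.
exact: sqr_ge0.
Qed.

(** Only absolute values agree: at t = L/2 both [wrap L t] and [wrap L (- t)] equal -L/2. Minimality
    of [wrap] gives one inequality, applied in both directions. *)
Lemma norm_wrapN L t : 0 < L -> `|wrap L (- t)| = `|wrap L t|.
Proof.
move=> L0; have le s : `|wrap L (- s)| <= `|wrap L s|.
  rewrite (le_trans (wrap_min L0 _ (- Num.floor (s / L + 2^-1)))) ?intrN//.
  by rewrite mulrN opprK -normrN opprD opprK.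
by apply/eqP; rewrite eq_le le/= -[X in wrap L X]opprK le.
Qed.

Lemma wrapB L s t : 0 < L -> wrap L (wrap L s - wrap L t) = wrap L (s - t).
Proof.
move=> L0; rewrite {2 3}/wrap; set a := Num.floor _; set b := Num.floor _.
by rewrite -[RHS](wrapD L0 _ (b - a)) intrB; congr wrap; ring.
Qed.

Variables d n : nat.
Local Notation L := (@torus_side R d n).
Local Notation vol := (@volume R d).

Definition twrap (x : d.-tuple R) : d.-tuple R := [tuple wrap L (tnth x i) | i < d].

Definition treflect (a y : d.-tuple R) := twrap (point_sub a y).

Lemma measurable_twrap_sub :
  measurable_fun setT (fun z : d.-tuple R * d.-tuple R => twrap (point_sub z.1 z.2)).
Proof.
apply/measurable_fun_tnthP => i.
rewrite (_ : _ \o _ = fun z => wrap L (tnth z.1 i - tnth z.2 i)); last first.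
  by apply/funext => z; rewrite /= !tnth_mktuple.
apply: (measurableT_comp (measurable_wrap L)); apply: measurable_funB.
  exact: (measurableT_comp (@measurable_tnth _ R d i) measurable_fst).
exact: (measurableT_comp (@measurable_tnth _ R d i) measurable_snd).
Qed.

Lemma measurable_treflect a : measurable_fun setT (treflect a).
Proof. exact: (measurableT_comp measurable_twrap_sub (pair1_measurable a)). Qed.

HB.instance Definition _ a :=
  isMeasurableFun.Build _ _ _ _ (treflect a) (@measurable_treflect a).

Hypothesis n0 : (0 < n)%N.

Lemma torus_side_gt0 : 0 < L.
Proof. by apply: powR_gt0; rewrite ltr0n. Qed.

(** The Euclidean norm is monotone in each absolute coordinate, so wrapping every coordinate attains
    the infimum. *)
Lemma torus_distE (x y : d.-tuple R) : torus_dist n x y = enorm (treflect x y).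
Proof.
rewrite /torus_dist; set S := [set _ | _ in _].
have lbS : lbound S (enorm (treflect x y)).
  move=> _ [k _ <-]; apply: le_enorm => i; rewrite !tnth_mktuple opprD addrA.
  exact: wrap_min torus_side_gt0 _ _.
have SE : S (enorm (treflect x y)).
  exists [tuple Num.floor (tnth (point_sub x y) i / L + 2^-1) | i < d] => //.
  by congr enorm; apply: eq_from_tnth => i; rewrite !tnth_mktuple /wrap opprD addrA.
apply/eqP; rewrite eq_le; apply/andP; split.
  by apply: ge_inf => //; exists (enorm (treflect x y)).
by apply: lb_le_inf => //; exists (enorm (treflect x y)).
Qed.

Lemma torus_distC (x y : d.-tuple R) : torus_dist n x y = torus_dist n y x.
Proof.
rewrite !torus_distE; apply: eq_enorm => i; rewrite !tnth_mktuple.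
by rewrite -norm_wrapN ?torus_side_gt0// opprB.
Qed.

Variable r : R.
Hypothesis r0 : 0 < r.

Local Notation near := (fun x y : d.-tuple R => torus_dist n x y <= r).

Lemma torus_distC_near x y : near x y = near y x.
Proof. by rewrite /= torus_distC. Qed.

Lemma measurable_near : measurable [set z : d.-tuple R * d.-tuple R | near z.1 z.2].
Proof.
rewrite (_ : [set z | _] = [set z | enorm (twrap (point_sub z.1 z.2)) <= r]).
  apply: measurable_le_fun => //.
  exact: (measurableT_comp (@measurable_enorm R d) measurable_twrap_sub).
by apply/seteqP; split => z /=; rewrite torus_distE.
Qed.

(** From y - z = (x - z) - (x - y); the reflection exchanges the roles of the two points. *)
Lemma torus_dist_treflect x y z :
  torus_dist n y z = torus_dist n (treflect x z) (treflect x y).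
Proof.
rewrite !torus_distE; congr enorm; apply: eq_from_tnth => i.
rewrite !tnth_mktuple wrapB ?torus_side_gt0//; congr wrap; ring.
Qed.

Lemma eball_torus_box : 2 * r <= L -> @eball R d r `<=` torus_box d n.
Proof.
move=> rL x xr i; rewrite -ler_norml (le_trans (tnth_le_enorm x i))// (le_trans xr)//.
by lra.
Qed.

Lemma torus_dist_eball (y z : d.-tuple R) : 4 * r < L -> @eball R d r y -> @eball R d r z ->
  torus_dist n z y = enorm (point_sub y z).
Proof.
move=> rL yr zr; rewrite torus_distE; apply: eq_enorm => i; rewrite !tnth_mktuple.
rewrite wrap_id ?torus_side_gt0//; first by rewrite -normrN opprB.
have := le_trans (tnth_le_enorm y i) yr; have := le_trans (tnth_le_enorm z i) zr.
rewrite !ler_norml => /andP[h1 h2] /andP[h3 h4].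
by apply/andP; split; lra.
Qed.

Variable mu : probability (d.-tuple R) R.
Hypothesis muE : forall A, measurable A ->
  mu A = (n%:R^-1%:E * vol (A `&` torus_box d n))%E.

(** On rectangles both sides factor over the coordinates, where [lebesgue_wrap] applies. *)
Lemma treflect_law a B : measurable B -> distribution mu (treflect a) B = mu B.
Proof.
apply: finite_tuple_measure_unique; first exact: probability_lty.
move=> A mA; have mRA := measurable_rectangle mA.
have mtA : measurable (treflect a @^-1` rectangle A).
  by rewrite -[X in measurable X]setTI; apply: measurable_treflect.
transitivity (mu (treflect a @^-1` rectangle A)) => //.
apply: etrans (muE mtA) _; apply: etrans _ (esym (muE mRA)); congr (_ * _)%E.
pose box (C : set R) : set R := [set t | (- (L / 2) <= t <= L / 2) && `[< C t >]].
have mbox C : measurable C -> measurable (box C).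
  move=> mC; rewrite (_ : box C = `[- (L / 2), L / 2] `&` C); first exact: measurableI.
  apply/seteqP; split => t /=; rewrite in_itv/=; first by move=> /andP[-> /asboolP].
  by rewrite /box/= => -[-> /asboolP ->].
pose C i : set R := [set t | A i (wrap L (tnth a i - t))].
have mC i : measurable (C i).
  rewrite (_ : C i = (fun t => wrap L (tnth a i - t)) @^-1` A i)//.
  rewrite -[X in measurable X]setTI.
  apply: (measurableT_comp (measurable_wrap L) (measurable_funB _ _)) => //.
transitivity (vol (rectangle (fun i => box (C i)))).
  congr (volume d _); apply/seteqP; split => x /=.
    move=> [H1 H2] i; rewrite /box/= H2; apply/asboolP.
    by have := H1 i; rewrite !tnth_mktuple.
  move=> H; split => i; have /andP[h1 /asboolP h2] := H i => //.
  by rewrite !tnth_mktuple.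
transitivity (vol (rectangle (fun i => box (A i)))); last first.
  congr (volume d _); apply/seteqP; split => x /=.
    by move=> H; split => i; have /andP[h1 /asboolP h2] := H i.
  by move=> [H1 H2] i; rewrite /box/= H2; apply/asboolP; exact: H1.
rewrite [LHS]volume_box ?[RHS]volume_box//; last 2 first.
- by move=> i; exact: mbox.
- by move=> i; exact: mbox.
by apply: eq_bigr => i _; exact: lebesgue_wrap torus_side_gt0 _ _ (mA i).
Qed.

Lemma mean_treflect a (f : d.-tuple R -> R) : bmeas f ->
  \int[mu]_y f (treflect a y) = \int[mu]_y f y.
Proof.
by move=> bf; rewrite -(mean_distribution mu (treflect a))//; exact/mean_ext/treflect_law.
Qed.

Lemma mean_eball (f : d.-tuple R -> R) : 2 * r <= L -> bmeas f ->
  (forall x, 0 <= f x) -> (forall x, ~ @eball R d r x -> f x = 0) ->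
  \int[mu]_x f x = n%:R^-1 * \int[vol]_(x in @eball R d r) f x.
Proof.
move=> rL [mf _] f0 fb; have k0 : 0 <= n%:R^-1 :> R by rewrite invr_ge0.
have mB := @measurable_eball R d r.
transitivity (fine (\int[mscale (NngNum k0) vol]_(x in @eball R d r) (f x)%:E)).
  congr fine; transitivity (\int[mu]_(x in @eball R d r) (f x)%:E)%E.
    rewrite [RHS]integral_mkcond; apply: eq_integral => x _; rewrite patchE.
    by case: ifPn => // /negP; rewrite in_setE => /fb ->.
  apply: eq_measure_integral => A mA AB; apply: etrans (muE mA) _.
  by rewrite (setIidl (subset_trans AB (eball_torus_box rL))).
rewrite ge0_integral_mscale//; last first.
- by move=> x _; rewrite lee_fin.
- exact/measurable_EFinP/measurable_funTS.
(* An infinite integral is sent to 0 by [fine] on both sides. *)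
rewrite /Rintegral/=; case: (integral _ _ _) => [x| |]//=.
  by rewrite gt0_muley ?lte_fin ?invr_gt0 ?ltr0n// mulr0.
by rewrite gt0_muleNy ?lte_fin ?invr_gt0 ?ltr0n// mulr0.
Qed.

Lemma mean_near x : 2 * r <= L -> \int[mu]_y (near x y)%:R = omega d r / n%:R.
Proof.
move=> rL; have [oE _] := volume_ball d r0.
have mB := @measurable_eball R d r.
transitivity (\int[mu]_y (enorm y <= r)%R%:R).
  rewrite -(mean_treflect x (bmeas_bool mB)).
  by apply: eq_Rintegral => y _; rewrite torus_distE.
rewrite mean_bool// [X in fine X]muE//.
by rewrite (setIidl (eball_torus_box rL)) oE -EFinM mulrC.
Qed.

(** Reflecting [y] and [z] about [x] turns closeness to [x] into membership of the ball around 0 and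
    preserves the distance between [y] and [z]. Inside the ball [4 * r < L] makes that distance
    Euclidean, which is the integrand of [p_conn]. *)
Lemma mean_triangle x : 4 * r < L ->
  \int[mu]_y \int[mu]_z ((near x y)%:R * (near y z)%:R * (near x z)%:R) =
  omega d r ^+ 2 * p_conn d r / n%:R ^+ 2.
Proof.
move=> rL; have rL2 : 2 * r <= L.
  by rewrite ltW// (le_lt_trans _ rL)// ler_pM2r// ler_nat.
have [_ o0] := volume_ball d r0.
have mB := @measurable_eball R d r.
pose g (yz : d.-tuple R * d.-tuple R) : R :=
  (enorm yz.1 <= r)%R%:R * (near yz.2 yz.1)%R%:R * (enorm yz.2 <= r)%R%:R.
have bB : bmeas (fun y : d.-tuple R => (enorm y <= r)%R%:R : R) by exact: bmeas_bool.
have bg : bmeas g.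
  apply: bmeasM; last exact: (bmeas_comp measurable_snd bB).
  apply: bmeasM; first exact: (bmeas_comp measurable_fst bB).
  apply: (bmeas_comp (h := fun yz : d.-tuple R * d.-tuple R => (yz.2, yz.1)) _ (bmeas_bool measurable_near)).
  exact: measurable_fun_pair measurable_snd measurable_fst.
have bgy y : bmeas (fun z => g (y, z)) by exact: bmeas_pair1.
pose h y := \int[mu]_z g (y, z).
have bh : bmeas h by exact: bmeas_mean2.
pose J y : R := \int[vol]_(z in @eball R d r) (enorm (point_sub y z) <= r)%R%:R.
have g0 y z : 0 <= g (y, z) by rewrite !mulr_ge0.
have gB y z : @eball R d r y -> @eball R d r z -> g (y, z) = (enorm (point_sub y z) <= r)%R%:R.
  by move=> yr zr; rewrite /g/= torus_dist_eball// yr zr mul1r mulr1.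
have hJ y : @eball R d r y -> h y = n%:R^-1 * J y.
  move=> yr; rewrite /h mean_eball//; last first.
    by move=> z /negP/negbTE zr; rewrite /g/= zr mulr0.
  by congr (_ * _); apply: eq_Rintegral => z /set_mem zr; exact: gB.
transitivity (\int[mu]_y h y).
  rewrite -(mean_treflect x bh); apply: eq_Rintegral => y _.
  rewrite /h -(mean_treflect x (bgy (treflect x y))); apply: eq_Rintegral => z _.
  by rewrite /g/= -torus_dist_treflect -!torus_distE.
have n0' : n%:R != 0 :> R by rewrite pnatr_eq0 -lt0n.
(* On the ball [n * h y] is the inner integral [J y] of [p_conn]; each of the two integrations over
   [mu] brings one factor [n^-1]. *)
transitivity (n%:R^-1 * \int[mu]_y (n%:R * h y)).
  by rewrite meanZ// mulKf.
rewrite mean_eball//; last 3 first.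
- exact: bmeasZ.
- by move=> y; rewrite mulr_ge0//; apply: Rintegral_ge0 => z _; exact: g0.
- move=> y /negP/negbTE yr; rewrite /h.
  under eq_Rintegral do rewrite /g/= yr !mul0r.
  by rewrite mean_cst mulr0.
rewrite /p_conn mulVKf ?expf_neq0 ?gt_eqF// [RHS]mulrC mulrA -invfM -expr2; congr (_ * _).
by apply: eq_Rintegral => y /set_mem yr; rewrite hJ// mulVKf.
Qed.

Variable p : R.
Hypothesis p01 : 0 <= p <= 1.

Local Notation pr := (@edge_law _ _ _ mu near p n).

Lemma up_edge_law (A : {set 'I_n * 'I_n}) : (forall e, e \in A -> (e.1 < e.2)%N) ->
  up pr A = @incl _ _ _ mu near p n A.
Proof.
move=> A12; rewrite -sum_upset_edge_law//; last exact: measurable_near.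
rewrite [RHS]big_mkcond; apply: eq_bigr => E _.
by case: ifP; rewrite ?mulr1 ?mulr0.
Qed.

(** The triangle probability p^3 omega^2 p_conn / n^2 is written as lambda^2 rho / n^2 with lambda =
    p omega and rho = p p_conn, the form taken by the Poisson limits. *)
Lemma random_graph_torus : 4 * r < L ->
  random_graph pr (p * omega d r / n%:R)
    ((p * omega d r) ^+ 2 * (p * p_conn d r) / n%:R ^+ 2).
Proof.
move=> rL; have rL2 : 2 * r <= L.
  by rewrite ltW// (le_lt_trans _ rL)// ler_pM2r// ler_nat.
have mN := measurable_near.
split.
- by move=> E; exact: law_ge0.
- have := @sum_edge_law _ _ _ mu near p n mN (fun=> 1); rewrite mean_cst => ->.
  by apply: eq_bigr => E _; rewrite mulr1.
- move=> A u w uw Aw; rewrite !up_edge_law; last 2 first.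
  + by move=> e /Aw[].
  + by move=> e; rewrite !inE => /orP[/eqP ->|/Aw[]//]; exact: opair_lt.
  rewrite (@incl_leaf _ _ _ mu near p n mN torus_distC_near A u w (omega d r / n%:R))//.
  + by rewrite mulrA.
  + by move=> x; exact: mean_near.
  + by move=> e /Aw[].
- move=> u v w uv vw uw; rewrite up_edge_law; last first.
    by move=> e; rewrite !inE => /orP[/orP[]|] /eqP ->; exact: opair_lt.
  rewrite (@incl_triangle _ _ _ mu near p n mN torus_distC_near u v w
    (omega d r ^+ 2 * p_conn d r / n%:R ^+ 2))//; last by move=> x; exact: mean_triangle.
  by rewrite !mulrA; ring.
- exact: edge_law_variance.
Qed.

End torus_metric.

Lemma torus_side_near {R : realType} d (c : R) : (1 <= d)%N -> 0 <= c ->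
  exists N, forall n, (N <= n)%N -> (0 < n)%N /\ c < torus_side d n.
Proof.
move=> d1 c0; exists (Num.truncn (c ^+ d)).+1 => n Nn.
have cn : c ^+ d < n%:R by rewrite (lt_le_trans (truncnS_gt _))// ler_nat.
split; first exact: leq_trans Nn.
have d0 : d%:R != 0 :> R by rewrite pnatr_eq0 -lt0n.
have -> : c = (c ^+ d) `^ d%:R^-1.
  by rewrite -powR_mulrn// -powRrM mulfV// powRr1.
by apply: gt0_ltr_powR => //; rewrite ?invr_gt0 ?ltr0n// nnegrE ?exprn_ge0.
Qed.

Theorem proposition3p6 (R : realType) (d : nat) (hd : (1 <= d)%N)
    (r p : R) (hr : 0 < r) (hp : 0 < p <= 1)
    (dO : nat -> measure_display) (Omega : forall n, measurableType (dO n))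
    (P : forall n, probability (Omega n) R)
    (X : forall n, 'I_n -> {RV (P n) >-> (d.-tuple R)})
    (RGG : forall n, Omega n -> simple_graph 'I_n)
    (hRGG : forall n, (1 <= n)%N -> is_RGG p r (X n) (RGG n))
    (k : nat) (hk : (1 <= k)%N) :
  cvg_in_probability P (fun n w => annd (RGG n w) k)
    (1 + p * omega d r * (1 - p * p_conn d r) + p * (k%:R - 1) * p_conn d r).
Proof.
move=> eps eps0; have /andP[p0 p1] := hp.
have p01 : 0 <= p <= 1 by rewrite ltW.
case: k hk => // k _.
have [_ o0] := volume_ball d hr.
have r4 : 0 <= 4 * r by rewrite mulr_ge0// ltW.
have [N NL] := torus_side_near hd r4.
pose lambda := p * omega d r; pose rho := p * p_conn d r.
have edge_dist n : exists pr : {set 'I_n * 'I_n} -> R, (N <= n)%N ->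
    random_graph pr (lambda / n%:R) (lambda ^+ 2 * rho / n%:R ^+ 2) /\
    forall B : pred {set 'I_n * 'I_n},
      P n [set w | B (edge_set (RGG n w))] = (\sum_(E | B E) pr E)%:E.
  (* The family of laws has to be defined for every [n]; for small tori a dummy is used. *)
  have [Nn|] := leqP N n; last by exists (fun=> 0).
  have [n0 rL] := NL n Nn; have GX := hRGG n n0.
  (* The law of one vertex serves as the uniform law on the torus, already known to be a
     probability. *)
  pose mu : probability (d.-tuple R) R := distribution (P n) (X n (Ordinal n0)).
  have muE A : measurable A -> mu A = (n%:R^-1%:E * volume d (A `&` torus_box d n))%E.
    exact: rgg_uniform GX (Ordinal n0) A.
  have Xmu i A : measurable A -> P n (X n i @^-1` A) = mu A.
    by move=> mA; rewrite muE//; exact: rgg_uniform GX i A mA.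
  exists (@edge_law _ _ _ mu (fun x y => torus_dist n x y <= r) p n) => _; split.
    exact: random_graph_torus.
  by move=> B; exact: (rgg_edge_law p01 (measurable_near n0 r) GX Xmu B).
pose pr n := projT1 (cid (edge_dist n)).
have prP n : (N <= n)%N -> _ := projT2 (cid (edge_dist n)).
have limE : annd_limit lambda rho k =
    1 + p * omega d r * (1 - p * p_conn d r) + p * (k.+1%:R - 1) * p_conn d r.
  by rewrite /annd_limit /lambda /rho -natr1 addrK; ring.
have := @cvg_annd_edges R lambda rho k N pr (mulr_gt0 p0 o0)
  (fun n Nn => (prP n Nn).1) eps eps0.
rewrite -limE; set c := annd_limit lambda rho k => h.
have PE n : (N <= n)%N -> P n [set w | eps < `|annd (RGG n w) k.+1 - c|] =
    (\sum_(E | eps < `|annd_edges k.+1 E - c|) @pr n E)%:E.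
  move=> Nn; rewrite -((prP n Nn).2 (fun E => eps < `|annd_edges k.+1 E - c|)).
  by congr (P n _); apply/funext => w; rewrite /= annd_edgesE.
apply/fine_cvgP; split; first by exists N => // n /= Nn; rewrite PE.
by apply: (cvg_near_eq h erefl); exists N => // n /= Nn; rewrite PE.
Qed.
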